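(* Let $n>k\ge1$ be relatively prime integers. For all $\tau\in\mathbb{C}$, $$\mathrm{rel}_{n,k}(E,\tau)=\text{the image of } R_\tau(\tau):V^{\otimes2}\to V^{\otimes 2}.$$
   Context: Notation: $e(z)=e^{2\pi i z}$; $\mathbb{Z}_n=\mathbb{Z}/n\mathbb{Z}$. Fix $\eta\in\mathbb{C}$ in the upper half-plane, $\Lambda=\mathbb{Z}+\mathbb{Z}\eta$, $E=\mathbb{C}/\Lambda$, and $E[n]=\frac1n\Lambda/\Lambda$. Let $\theta(z)=\sum_{m\in\mathbb{Z}}(-1)^m e\big(mz+\tfrac12 m(m-1)\eta\big)$ and, for $\alpha\in\mathbb{Z}$, $$\theta_\alpha(z)=e\Big(\alpha z+\tfrac{\alpha}{2n}+\tfrac{\alpha(\alpha-n)}{2n}\eta\Big)\prod_{m=0}^{n-1}\theta\Big(z+\tfrac mn+\tfrac{\alpha}{n}\eta\Big),$$ which depends only on $\alpha$ modulo $n$; the zeros of the $\theta_\alpha$'s lie in $\frac1n\Lambda$. Let $V$ be a $\mathbb{C}$-vector space with basis $\{x_i\mid i\in\mathbb{Z}_n\}$. For $\tau\in\mathbb{C}-\frac1n\Lambda$ and $i,j\in\mathbb{Z}_n$ let $$r_{ij}(\tau)=\sum_{r\in\mathbb{Z}_n}\frac{\theta_{j-i+(k-1)r}(0)}{\theta_{j-i-r}(-\tau)\,\theta_{kr}(\tau)}\;x_{j-r}\otimes x_{i+r}\in V\otimes V.$$ Up to a non-zero scalar, $r_{ij}(\tau)$ depends only on $\tau+\Lambda$.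 If $r_{ij}$ is not identically zero on $\mathbb{C}-\frac1n\Lambda$, then it is nowhere zero there, and $\tau\mapsto L_{ij}(\tau):=\mathbb{C}\cdot r_{ij}(\tau)$ is a morphism $E-E[n]\to\mathbb{P}(V\otimes V)$ (the projective space of $1$-dimensional subspaces) that extends uniquely to a morphism $L_{ij}:E\to\mathbb{P}(V\otimes V)$; for $\tau\in\mathbb{C}$, $L_{ij}(\tau)\subseteq V\otimes V$ denotes the line that is the image of $\tau+\Lambda$. For all $\tau\in\mathbb{C}$, $\mathrm{rel}_{n,k}(E,\tau)\subseteq V\otimes V$ is the linear span of these $L_{ij}(\tau)$'s (over all $(i,j)$ with $r_{ij}$ not identically zero). For $\tau\in\mathbb{C}-\frac1n\Lambda$ and $z\in\mathbb{C}$, the linear operator $R_\tau(z)$ on $V^{\otimes 2}$ is $$R_\tau(z)(x_i\otimes x_j)=\frac{\theta_0(-z)\cdots\theta_{n-1}(-z)}{\theta_1(0)\cdots\theta_{n-1}(0)}\sum_{r\in\mathbb{Z}_n}\frac{\theta_{j-i+r(k-1)}(-z+\tau)}{\theta_{j-i-r}(-z)\,\theta_{kr}(\tau)}\;x_{j-r}\otimes x_{i+r}$$ (holomorphic in $z$ after removing removable singularities). The function $\tau\mapsto R_\tau(\tau)$, holomorphic on $\mathbb{C}-\frac1n\Lambda$, extends uniquely to a holomorphic function $\mathbb{C}\to\mathrm{End}_{\mathbb{C}}(V^{\otimes2})$; for $\tau\in\frac1n\Lambda$, $R_\tau(\tau)$ denotes the value of this extension. *)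

(* Defs.v *)
From HB Require Import structures.
From mathcomp Require Import all_boot all_order all_algebra.
From mathcomp Require Import all_classical all_reals all_analysis.
From mathcomp Require Import complex.

Set Implicit Arguments.
Unset Strict Implicit.
Unset Printing Implicit Defensive.

Import Order.TTheory GRing.Theory Num.Theory.
Import numFieldNormedType.Exports.

Local Open Scope classical_set_scope.
Local Open Scope ring_scope.

(* Typed as a numClosedFieldType so that it inherits the generic topology and
   normed-module structure of a numFieldType.  For f from Cplx R to a normed
   module over Cplx R, [derivable f z 1] is complex differentiability at z. *)
Definition Cplx (R : realType) : numClosedFieldType := R[i].

Definition cexp (R : realType) (z : Cplx R) : Cplx R :=
  let x := complex.Re z in let y := complex.Im z in
  (expR x * cos y +i* (expR x * sin y))%C.

(* e(z) = exp(2 pi i z) *)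
Definition e_ (R : realType) (z : Cplx R) : Cplx R :=
  cexp ((0 +i* (2 * pi))%C * z).

(* sum over all m in Z, as the sum over m >= 0 plus the sum over m <= -1 *)
Definition sumZ (R : realType) (u : int -> Cplx R) : Cplx R :=
  limn (series (fun m : nat => u m%:Z)) +
  limn (series (fun m : nat => u (- m.+1%:Z))).

Definition lattice (R : realType) (eta : Cplx R) : set (Cplx R) :=
  [set z | exists a b : int, z = a%:~R + b%:~R * eta].

(* (1/n) Lambda, the inverse image of E[n] in the complex plane *)
Definition torsion (R : realType) (n : nat) (eta : Cplx R) : set (Cplx R) :=
  [set z / n%:R | z in lattice eta].

Definition theta (R : realType) (eta z : Cplx R) : Cplx R :=
  sumZ (fun m : int =>
    (-1) ^ m * e_ (m%:~R * z + m%:~R * (m%:~R - 1) / 2 * eta)).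

Definition theta_ (R : realType) (n : nat) (eta : Cplx R) (alpha : int)
    (z : Cplx R) : Cplx R :=
  let a : Cplx R := alpha%:~R in
  e_ (a * z + a / (2 * n%:R) + a * (a - n%:R) / (2 * n%:R) * eta) *
  \prod_(m < n) theta eta (z + m%:R / n%:R + a / n%:R * eta).

(* theta_alpha for alpha in Z/nZ; since it depends only on alpha modulo n, it
   is read off the representative of alpha in {0, ..., n-1} (for n > 1). *)
Definition thetaZ (R : realType) (n : nat) (eta : Cplx R) (alpha : 'Z_n)
    (z : Cplx R) : Cplx R :=
  theta_ n eta (nat_of_ord alpha)%:Z z.

(* V has basis (x_i), i in Z/nZ; as a type 'Z_n is 'I_(Zp_trunc n).+2, which is
   'I_n when n > 1. *)
Notation Vsp R n := 'rV[Cplx R]_((Zp_trunc n).+2) (only parsing).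

(* V (x) V is the space of square matrices, u (x) v being the outer product. *)
Notation V2 R n := 'M[Cplx R]_((Zp_trunc n).+2) (only parsing).

Definition tens (R : realType) (n : nat) (u v : Vsp R n) : V2 R n := u^T *m v.

Definition xbase (R : realType) (n : nat) (i : 'Z_n) : Vsp R n := delta_mx 0 i.

Definition xx (R : realType) (n : nat) (i j : 'Z_n) : V2 R n :=
  tens (xbase R i) (xbase R j).

(* the linear endomorphism of V (x) V sending x_i (x) x_j to v i j *)
Definition opxx (R : realType) (n : nat) (v : 'Z_n -> 'Z_n -> V2 R n) :
    'End(V2 R n) :=
  linfun (fun A : V2 R n =>
    \sum_(i : 'Z_n) \sum_(j : 'Z_n) A i j *: v i j).

Lemma opxxE (R : realType) (n : nat) (v : 'Z_n -> 'Z_n -> V2 R n)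
  (i j : 'Z_n) : opxx v (xx R i j) = v i j.
Proof.
pose f (A : V2 R n) : V2 R n := \sum_(a : 'Z_n) \sum_(b : 'Z_n) A a b *: v a b.
have f_lin : linear f.
  move=> c A B; rewrite /f scaler_sumr -big_split; apply: eq_bigr => a _ /=.
  rewrite scaler_sumr -big_split; apply: eq_bigr => b _ /=.
  by rewrite !mxE scalerDl scalerA.
pose g : {linear V2 R n -> V2 R n} :=
  HB.pack f (GRing.isLinear.Build _ _ _ _ f f_lin).
rewrite /opxx -[LHS]/(linfun g (xx R i j)) lfunE /= /f.
have xxE : xx R i j = delta_mx i j by rewrite /xx /tens trmx_delta mul_delta_mx.
rewrite xxE (bigD1 i) //= (bigD1 j) //= mxE !eqxx scale1r.
rewrite big1 ?addr0 => [|b /negPf bj]; last by rewrite mxE bj andbF scale0r.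
rewrite big1 ?addr0 // => a /negPf ai.
by rewrite big1 // => b _; rewrite mxE ai scale0r.
Qed.

(* F is an entire function with values in End(V (x) V): this is tested
   after evaluation at each vector. *)
Definition entire_End (R : realType) (n : nat)
    (F : Cplx R -> 'End(V2 R n)) : Prop :=
  forall (w : V2 R n) (z : Cplx R),
    derivable (fun t : Cplx R => F t w) z 1.

(* the entire function that agrees with F outside S (unique when S is a closed
   discrete set) *)
Definition entire_ext (R : realType) (n : nat) (S : set (Cplx R))
    (F : Cplx R -> 'End(V2 R n)) :
    Cplx R -> 'End(V2 R n) :=
  xget (fun=> 0)
    [set G | entire_End G /\ forall z, ~ S z -> G z = F z].

(* L is a holomorphic map to the projective space of lines of V (x) V: locally
   it lifts to a nowhere vanishing holomorphic function. *)
Definition holo_proj (R : realType) (n : nat)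
    (L : Cplx R -> {vspace V2 R n}) : Prop :=
  forall z0 : Cplx R, exists v : Cplx R -> V2 R n,
    \forall z \near z0, [/\ derivable v z 1, v z != 0 & L z = <[v z]>%VS].

(* A morphism from E = C/Lambda to the projective space is given by the
   Lambda-periodic holomorphic map that it induces on C (an algebraic and a
   holomorphic map between these projective varieties are the same thing). *)
Definition morphism_E (R : realType) (n : nat) (eta : Cplx R)
    (L : Cplx R -> {vspace V2 R n}) : Prop :=
  holo_proj L /\
  forall z lam : Cplx R, lattice eta lam -> L (z + lam) = L z.

Definition r_ (R : realType) (n k : nat) (eta : Cplx R) (i j : 'Z_n)
    (tau : Cplx R) : V2 R n :=
  \sum_(r : 'Z_n)
    (thetaZ eta (j - i + (k%:R - 1) * r) 0 /
     (thetaZ eta (j - i - r) (- tau) * thetaZ eta (k%:R * r) tau))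
    *: xx R (j - r) (i + r).

Definition r_nonzero (R : realType) (n k : nat) (eta : Cplx R) (i j : 'Z_n) :
    Prop :=
  exists tau : Cplx R, ~ torsion n eta tau /\ r_ k eta i j tau <> 0.

(* the morphism E -> P(V (x) V) that extends tau |-> C . r_ij(tau) *)
Definition L_ (R : realType) (n k : nat) (eta : Cplx R) (i j : 'Z_n) :
    Cplx R -> {vspace V2 R n} :=
  xget (fun=> 0%VS)
    [set L | morphism_E eta L /\
      forall tau, ~ torsion n eta tau -> L tau = <[r_ k eta i j tau]>%VS].

Definition rel_ (R : realType) (n k : nat) (eta tau : Cplx R) :
    {vspace V2 R n} :=
  (\sum_(p : 'Z_n * 'Z_n | `[< r_nonzero k eta p.1 p.2 >])
     L_ k eta p.1 p.2 tau)%VS.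

(* the formula that defines R_tau(z) for z outside (1/n) Lambda *)
Definition R_formula (R : realType) (n k : nat) (eta tau z : Cplx R) :
    'End(V2 R n) :=
  opxx (fun i j : 'Z_n =>
    ((\prod_(a : 'Z_n) thetaZ eta a (- z)) /
     (\prod_(a : 'Z_n | a != 0) thetaZ eta a 0)) *:
    \sum_(r : 'Z_n)
      (thetaZ eta (j - i + r * (k%:R - 1)) (- z + tau) /
       (thetaZ eta (j - i - r) (- z) * thetaZ eta (k%:R * r) tau))
      *: xx R (j - r) (i + r)).

(* R_tau(z), meant for tau outside (1/n) Lambda, with the removable
   singularities in z removed *)
Definition R_ (R : realType) (n k : nat) (eta tau : Cplx R) :
    Cplx R -> 'End(V2 R n) :=
  entire_ext (torsion n eta) (R_formula n k eta tau).

(* R_tau(tau) for all tau: the entire extension of tau |-> R_tau(tau) *)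
Definition R_diag (R : realType) (n k : nat) (eta : Cplx R) :
    Cplx R -> 'End(V2 R n) :=
  entire_ext (torsion n eta) (fun tau => R_ n k eta tau tau).

(* Main.v *)
Require Import Defs.
From mathcomp Require Import all_boot all_order all_algebra.
From mathcomp Require Import all_classical all_reals all_analysis.
From mathcomp Require Import complex ring lra zify.

(** Put d = j - i.  The r-th coefficient of r_ij(tau) has the denominator
    theta_{d-r}(-tau) theta_{kr}(tau), and theta_{kr}(tau) is theta_{-kr}(-tau)
    up to an explicit unit.  Multiplying r_ij(tau) by the product of all the
    theta_a(-tau) therefore cancels both factors as soon as the indices d - r
    and - kr differ; and they coincide exactly when the numerator
    theta_{d+(k-1)r}(0) is theta_0(0) = 0.  The cleared vector is thus entire
    in tau, and it is, up to one non-zero constant, R_tau(tau)(x_i (x) x_j):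
    away from (1/n)Lambda by definition and everywhere by density ([R_diagE]).
    So the image of R_tau(tau) is the span of the cleared vectors.

    To compare it with the lines L_ij, say that tau in (1/n)Lambda has class b
    when b is the only index with theta_b(-tau) = 0.  If (k-1)b = kd, then every
    surviving coefficient of the cleared vector still contains theta_b(-tau), and
    the vector vanishes at the points of class b: call such a b exceptional for
    (i, j).  Clearing denominators with the ordinary (non exceptional) indices
    only gives an entire vector that, unless r_ij is identically zero, vanishes
    nowhere, because at a point of ordinary class b the coefficient r = d - b survives, and at a point of
    exceptional class all the coefficients do ([cleared_neq0]).  Hence L_ij(tau)
    is the line spanned by this smaller vector ([L_E]), and the image of
    R_tau(tau) is contained in the sum of the L_ij(tau).

    The converse inclusion is immediate unless the class b of tau is exceptional
    for (i, j).  In that case, when (k-1)s <> 0, the vector of R_tau(tau) attached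
    to (i - s, j + s) has just two non-zero coefficients at tau, on the basis
    vectors numbered r0 + s and r0 - s of the line L_ij, where r0 = - b/k.  The
    transformation laws of the theta_a under translation by (1/n)Lambda and
    under z -> -z show that these two coefficients are proportional to the
    coefficients of L_ij on the same two vectors ([ccoef_ratio]).  Adding over s
    expresses twice the generator of L_ij(tau) in the image
    ([cleared_exceptional_limg]).

    All this requires theta to be entire and to vanish only on Lambda.  With
    q = e(eta) and w = e(z), theta(z) = A(1/w) - w A(w) for an entire power
    series A ([theta_half_theta]), which gives holomorphy and the functional
    equations.  The zeros come from the finite form of the Jacobi triple product
    ([finite_jacobi]), a consequence of the q-binomial theorem: up to an error
    O(|q|^N), theta(z) is (q;q)_N times a product of 2N + 1 linear factors
    ([theta_jacobi]), and that product stays away from 0 when no factor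
    vanishes. *)

Set Implicit Arguments.
Unset Strict Implicit.
Unset Printing Implicit Defensive.

Import Order.TTheory GRing.Theory Num.Theory.
Import numFieldNormedType.Exports.

Local Open Scope classical_set_scope.
Local Open Scope ring_scope.

(** * The real modulus of a complex number *)

Section Modulus.
Variable R : realType.
Local Notation K := (Cplx R).
Implicit Types z w : K.

Definition ofR (x : R) : K := (x +i* 0)%C.

(** The norm of a complex number is itself of complex type; its real part is
    used so that estimates take place in a totally ordered field. *)
Definition cabs z : R := complex.Re `|z|.

Lemma norm_cabs z : `|z| = ofR (cabs z).
Proof. by rewrite /cabs normc_def. Qed.

Lemma cabsE z : cabs z = Num.sqrt ((complex.Re z) ^+ 2 + (complex.Im z) ^+ 2).
Proof. by rewrite /cabs normc_def. Qed.

Lemma ofRD x y : ofR (x + y) = ofR x + ofR y.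
Proof. by apply/eqP; rewrite eq_complex /= addr0 !eqxx. Qed.
Lemma ofRN x : ofR (- x) = - ofR x.
Proof. by apply/eqP; rewrite eq_complex /= oppr0 !eqxx. Qed.
Lemma ofRM x y : ofR (x * y) = ofR x * ofR y.
Proof. by apply/eqP; rewrite eq_complex /= !(mul0r, mulr0, addr0, subr0) !eqxx. Qed.
Lemma ofR_le x y : (ofR x <= ofR y) = (x <= y).
Proof. exact: lecR. Qed.
Lemma ofR_lt x y : (ofR x < ofR y) = (x < y).
Proof. exact: ltcR. Qed.
Lemma ofR0 : ofR 0 = 0. Proof. by []. Qed.
Lemma ofR_inj : injective ofR. Proof. by move=> x y []. Qed.

Lemma cabs_ge0 z : 0 <= cabs z.
Proof. by rewrite -ofR_le -norm_cabs ofR0 normr_ge0. Qed.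
Lemma cabs0 : cabs 0 = 0. Proof. by rewrite /cabs normr0. Qed.
Lemma cabs1 : cabs 1 = 1. Proof. by rewrite /cabs normr1. Qed.
Lemma cabs_eq0 z : (cabs z == 0) = (z == 0).
Proof. by rewrite -(normr_eq0 z) norm_cabs -ofR0 (inj_eq ofR_inj). Qed.
Lemma cabs_gt0 z : (0 < cabs z) = (z != 0).
Proof. by rewrite lt_def cabs_ge0 cabs_eq0 andbT. Qed.
Lemma cabsN z : cabs (- z) = cabs z. Proof. by rewrite /cabs normrN. Qed.
Lemma cabsM z w : cabs (z * w) = cabs z * cabs w.
Proof. by apply: ofR_inj; rewrite ofRM -!norm_cabs normrM. Qed.
Lemma cabsX z m : cabs (z ^+ m) = cabs z ^+ m.
Proof. by elim: m => [|m IH]; rewrite ?expr0 ?cabs1 // !exprS cabsM IH. Qed.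
Lemma cabsV z : cabs z^-1 = (cabs z)^-1.
Proof.
have [->|z0] := eqVneq z 0; first by rewrite invr0 cabs0 invr0.
have n0 : cabs z != 0 by rewrite cabs_eq0.
by apply: (mulfI n0); rewrite -cabsM divff // cabs1 divff.
Qed.
Lemma cabsD z w : cabs (z + w) <= cabs z + cabs w.
Proof. by rewrite -ofR_le ofRD -!norm_cabs ler_normD. Qed.
Lemma cabsB z w : cabs z - cabs w <= cabs (z - w).
Proof. by rewrite lerBlDr; apply: le_trans (cabsD _ _); rewrite subrK. Qed.
Lemma cabs_sum (I : Type) (s : seq I) (P : pred I) (f : I -> K) :
  cabs (\sum_(i <- s | P i) f i) <= \sum_(i <- s | P i) cabs (f i).
Proof.
elim/big_rec2: _ => [|i a b _ H]; first by rewrite cabs0.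
by apply: le_trans (cabsD _ _) _; rewrite lerD2l.
Qed.
Lemma cabs_prod (I : Type) (s : seq I) (P : pred I) (f : I -> K) :
  cabs (\prod_(i <- s | P i) f i) = \prod_(i <- s | P i) cabs (f i).
Proof.
elim/big_rec2: _ => [|i a b _ H]; first by rewrite cabs1.
by rewrite cabsM H.
Qed.
Lemma cabs_ofR x : cabs (ofR x) = `|x|.
Proof. by rewrite cabsE /= expr0n addr0 sqrtr_sqr. Qed.
Lemma ofR_nat m : ofR m%:R = m%:R.
Proof. by elim: m => [|m IH] //; rewrite -!natr1 ofRD IH. Qed.
Lemma cabs_nat m : cabs m%:R = m%:R.
Proof. by rewrite -ofR_nat cabs_ofR normr_nat. Qed.
Lemma cabs_Re z : `|complex.Re z| <= cabs z.
Proof. by rewrite cabsE -sqrtr_sqr ler_wsqrtr // lerDl sqr_ge0. Qed.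
Lemma cabs_Im z : `|complex.Im z| <= cabs z.
Proof. by rewrite cabsE -sqrtr_sqr ler_wsqrtr // lerDr sqr_ge0. Qed.
(** With the two previous bounds, this reduces convergence and smallness to the
    two real coordinates. *)
Lemma cabs_ReIm z : cabs z <= `|complex.Re z| + `|complex.Im z|.
Proof.
rewrite cabsE; set a := complex.Re z; set b := complex.Im z.
have s0 : 0 <= `|a| + `|b| by rewrite addr_ge0.
rewrite -(ger0_norm s0) -(sqrtr_sqr (_ + _)) ler_wsqrtr //.
rewrite sqrrD !real_normK ?num_real // -subr_ge0.
suff: 0 <= `|a| * `|b| by lra.
exact: mulr_ge0.
Qed.

Lemma cvg_cabsP (T : Type) (F : set_system T) (FF : Filter F) (f : T -> K) (l : K) :
  (f @ F --> l) <-> (forall e : R, 0 < e -> \forall x \near F, cabs (l - f x) < e).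
Proof.
split=> [/cvgrPdist_lt H e e0|H].
  have /H : 0 < ofR e by rewrite -ofR0 ofR_lt.
  by apply: filterS => x; rewrite norm_cabs ofR_lt.
apply/cvgrPdist_lt => e e0.
have eE : e = ofR (complex.Re e).
  by apply/eqP; rewrite eq_complex /= (ger0_Im (ltW e0)) !eqxx.
have : 0 < complex.Re e by rewrite -ofR_lt -eE.
move/H; apply: filterS => x; rewrite -ofR_lt -norm_cabs -eE //.
Qed.

End Modulus.

(** * Series dominated by a geometric series *)

Section GeometricSeries.
Variable R : realType.
Local Notation K := (Cplx R).
Implicit Types (a b : nat -> K) (C : R).

(** The ratio 1/2 is a normalisation: all the series below decrease faster than
    any geometric one, and a fixed ratio makes the sum at most twice the bound. *)
Definition geom_bounded C a := forall m, cabs (a m) <= C / 2 ^+ m.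

Definition series_sum a : K := limn (series a).

Lemma real_geom_bounded_cvg (u : nat -> R) C :
  (forall m, `|u m| <= C / 2 ^+ m) -> cvgn (series u).
Proof.
move=> H; apply: normed_cvg.
apply: (@series_le_cvg _ _ (geometric C 2^-1)) => //.
- by move=> m; apply: normr_ge0.
- by move=> m; rewrite /geometric /= exprVn; apply: le_trans (H m); apply: normr_ge0.
- by move=> m; rewrite /geometric /= exprVn; apply: H.
- by apply: is_cvg_geometric_series; rewrite ger0_norm ?invr_ge0 // invf_lt1 ?ltr1n.
Qed.

Lemma Re_sum (I : Type) (s : seq I) (P : pred I) (f : I -> K) :
  complex.Re (\sum_(i <- s | P i) f i) = \sum_(i <- s | P i) complex.Re (f i).
Proof. by elim/big_rec2: _ => // i x y _ <-; case: (f i) y => ? ? []. Qed.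

Lemma Im_sum (I : Type) (s : seq I) (P : pred I) (f : I -> K) :
  complex.Im (\sum_(i <- s | P i) f i) = \sum_(i <- s | P i) complex.Im (f i).
Proof. by elim/big_rec2: _ => // i x y _ <-; case: (f i) y => ? ? []. Qed.

(** Completeness of the complex plane, obtained from that of the reals one
    coordinate at a time. *)
Lemma geom_bounded_cvg a C : geom_bounded C a -> series a @ \oo --> series_sum a.
Proof.
move=> H.
have /real_geom_bounded_cvg cr : forall m, `|complex.Re (a m)| <= C / 2 ^+ m.
  by move=> m; apply: le_trans (H m); apply: cabs_Re.
have /real_geom_bounded_cvg ci : forall m, `|complex.Im (a m)| <= C / 2 ^+ m.
  by move=> m; apply: le_trans (H m); apply: cabs_Im.
set l1 := lim _ in cr; set l2 := lim _ in ci.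
suff Hl : series a @ \oo --> ((l1 +i* l2)%C : K) by rewrite /series_sum (cvg_lim _ Hl).
apply/cvg_cabsP => e e0.
have e2 : 0 < e / 2 by rewrite divr_gt0.
move/cvgrPdist_lt : cr => /(_ _ e2) cr; move/cvgrPdist_lt : ci => /(_ _ e2) ci.
near=> N.
apply: le_lt_trans (cabs_ReIm _) _.
have h1 : `|l1 - series (fun m => complex.Re (a m)) N| < e / 2 by near: N.
have h2 : `|l2 - series (fun m => complex.Im (a m)) N| < e / 2 by near: N.
have -> : complex.Re ((l1 +i* l2)%C - series a N) =
    l1 - series (fun m => complex.Re (a m)) N.
  by rewrite /series /= -Re_sum; case: (\sum_(_ <= _ < _) _).
have -> : complex.Im ((l1 +i* l2)%C - series a N) =
    l2 - series (fun m => complex.Im (a m)) N.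
  by rewrite /series /= -Im_sum; case: (\sum_(_ <= _ < _) _).
by rewrite [e]splitr ltrD.
Unshelve. all: by end_near.
Qed.

Lemma cvg_series_sum a (l : K) : series a @ \oo --> l -> series_sum a = l.
Proof. by move=> H; apply: cvg_lim. Qed.

Lemma cvg_series_sum_eq a (f : nat -> K) (l : K) :
  (forall N, \sum_(0 <= m < N) a m = f N) -> f @ \oo --> l -> series_sum a = l.
Proof. by move=> /funext <- H; apply: cvg_lim. Qed.

Lemma series_sumD a b C D : geom_bounded C a -> geom_bounded D b ->
  series_sum (fun m => a m + b m) = series_sum a + series_sum b.
Proof.
move=> /geom_bounded_cvg ha /geom_bounded_cvg hb.
apply: (cvg_series_sum_eq _ (cvgD ha hb)) => N.
by rewrite big_split.
Qed.

Lemma series_sumZ (c : K) a C : geom_bounded C a ->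
  series_sum (fun m => c * a m) = c * series_sum a.
Proof.
move=> /geom_bounded_cvg ha.
apply: (cvg_series_sum_eq _ (cvgM (cvg_cst c) ha)) => N.
by rewrite -mulr_sumr.
Qed.

Lemma geom_bounded_ge0 a C : geom_bounded C a -> 0 <= C.
Proof. by move/(_ 0); rewrite expr0 divr1; apply: le_trans; apply: cabs_ge0. Qed.

Lemma geom_boundedZ (c : K) a C : geom_bounded C a ->
  geom_bounded (cabs c * C) (fun m => c * a m).
Proof. by move=> H m; rewrite cabsM -mulrA ler_wpM2l ?cabs_ge0. Qed.

Lemma geom_boundedD a b C D : geom_bounded C a -> geom_bounded D b ->
  geom_bounded (C + D) (fun m => a m + b m).
Proof. by move=> ha hb m; apply: le_trans (cabsD _ _) _; rewrite mulrDl lerD. Qed.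

Lemma geom_half_sum_le C N : 0 <= C -> \sum_(m < N) C / 2 ^+ m <= 2 * C.
Proof.
move=> C0; suff -> : \sum_(m < N) C / 2 ^+ m = 2 * C - 2 * C / 2 ^+ N.
  by rewrite gerBl divr_ge0 ?mulr_ge0 ?exprn_ge0.
elim: N => [|N IH]; first by rewrite big_ord0 expr0; lra.
by rewrite big_ord_recr /= IH exprS; field; rewrite expf_neq0.
Qed.

Lemma cabs_lim_le (f : nat -> K) (l : K) C :
  f @ \oo --> l -> (\forall N \near \oo, cabs (f N) <= C) -> cabs l <= C.
Proof.
move=> /cvg_cabsP H B; apply/ler_addgt0Pl => e e0.
near \oo => N.
have h1 : cabs (l - f N) < e by near: N; apply: H.
have h2 : cabs (f N) <= C by near: N.
rewrite -[l](subrK (f N)); apply: le_trans (cabsD _ _) _.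
by rewrite lerD // ltW.
Unshelve. all: by end_near.
Qed.

Lemma series_sum_bound a C : geom_bounded C a -> cabs (series_sum a) <= 2 * C.
Proof.
move=> H; apply: (cabs_lim_le (geom_bounded_cvg H)); apply: nearW => N.
rewrite /series /= big_mkord; apply: le_trans (cabs_sum _ _ _) _.
apply: le_trans (geom_half_sum_le N (geom_bounded_ge0 H)).
by apply: ler_sum => m _; apply: H.
Qed.

End GeometricSeries.

(** * Complex differentiability and entire power series *)

Section Differentiation.
Variable R : realType.
Local Notation K := (Cplx R).

(** The usual difference quotient condition multiplied by h, so that h = 0 needs
    no separate treatment. *)
Definition is_der (f : K -> K) (z l : K) := forall e : R, 0 < e ->
  exists2 d : R, 0 < d &
    forall h : K, cabs h < d -> cabs (f (h + z) - f z - h * l) <= e * cabs h.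

Lemma is_der_derivable (f : K -> K) (z l : K) :
  is_der f z l -> derivable f z 1.
Proof.
move=> H; apply: (cvgP l).
apply/cvg_cabsP => e e0.
have [d d0 Hd] := H _ (divr_gt0 e0 (ltr0Sn R 1)).
near=> h.
have h0 : h != 0 by near: h; exact: nbhs_dnbhs_neq.
have hd : cabs h < d.
  near: h; apply: nbhs_dnbhs.
  apply/nbhs_ballP; exists (ofR d); first by rewrite /= -ofR0 ofR_lt.
  by move=> h /=; rewrite -ball_normE /= sub0r normrN norm_cabs ofR_lt.
have -> : l - h^-1 *: ((f \o shift z) (h *: 1) - f z) =
  - (h^-1 * (f (h + z) - f z - h * l)).
  rewrite /= /shift /= /GRing.scale /= mulr1 [in RHS]mulrBr mulKf // opprB.
  by [].
rewrite cabsN cabsM cabsV.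
have n0 : 0 < cabs h by rewrite cabs_gt0.
apply: le_lt_trans (_ : (cabs h)^-1 * (e / 2 * cabs h) < e).
  by rewrite ler_wpM2l ?invr_ge0 ?cabs_ge0 // Hd.
rewrite mulrCA mulVf ?gt_eqF // mulr1; lra.
Unshelve. all: by end_near.
Qed.

(** A Taylor remainder of order two suffices for differentiability. *)
Lemma quadratic_is_der (f : K -> K) (z l : K) (C : R) :
  (forall h : K, cabs h <= 1 -> cabs (f (h + z) - f z - h * l) <= C * cabs h ^+ 2) ->
  is_der f z l.
Proof.
move=> H e e0; pose D := `|C| + 1.
have D0 : 0 < D by rewrite /D ltr_wpDl.
exists (Num.min 1 (e / D)); first by rewrite lt_min ltr01 divr_gt0.
move=> h; rewrite lt_min => /andP[h1 h2].
apply: le_trans (H _ (ltW h1)) _.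
rewrite expr2 mulrA ler_wpM2r ?cabs_ge0 //.
apply: le_trans (_ : D * cabs h <= _).
  by rewrite ler_wpM2r ?cabs_ge0 // /D; apply: le_trans (ler_norm _) _; lra.
by rewrite mulrC -ler_pdivlMr // ltW.
Qed.

End Differentiation.

Section PowerSeries.
Variable R : realType.
Local Notation K := (Cplx R).
Implicit Types (c : nat -> K) (x h : K).

(** The remainder D_m satisfies D_{m+1} = (h + x) D_m + h^2 m x^{m-1}; the factor
    2^m absorbs the m that this recursion produces. *)
Lemma pow_remainder x h (X : R) (m : nat) : 1 <= X -> cabs x + cabs h <= X ->
  cabs ((h + x) ^+ m - x ^+ m - h * (m%:R * x ^+ m.-1)) <= cabs h ^+ 2 * (2 * X) ^+ m.
Proof.
move=> X1 hX; have X0 : 0 <= X by apply: le_trans X1.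
have hxX : cabs (h + x) <= X by apply: le_trans (cabsD _ _) _; rewrite addrC.
have xX : cabs x <= X by apply: le_trans hX; rewrite lerDl cabs_ge0.
elim: m => [|m IH].
  by rewrite !expr0 mul0r mulr0 subr0 subrr cabs0 mulr1 sqr_ge0.
set D := (h + x) ^+ m - _ - _ in IH.
have -> : (h + x) ^+ m.+1 - x ^+ m.+1 - h * (m.+1%:R * x ^+ m) =
    (h + x) * D + h ^+ 2 * (m%:R * x ^+ m.-1).
  rewrite /D; case: m {IH D} => [|m] /=; first by rewrite !expr0 !expr1; ring.
  by rewrite !exprS -[m.+2%:R]natr1; ring.
apply: le_trans (cabsD _ _) _.
rewrite [cabs (_ * D)]cabsM [cabs (h ^+ 2 * _)]cabsM [cabs (_%:R * _)]cabsM (cabsX h) cabs_nat.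
have h1 : cabs (h + x) * cabs D <= X * (cabs h ^+ 2 * (2 * X) ^+ m).
  by rewrite ler_pM ?cabs_ge0.
have h2 : m%:R * cabs (x ^+ m.-1) <= 2 ^+ m * X ^+ m.
  rewrite cabsX ler_pM ?exprn_ge0 ?cabs_ge0 //.
    by rewrite -natrX ler_nat ltnW // ltn_expl.
  apply: le_trans (_ : X ^+ m.-1 <= _).
    by rewrite lerXn2r ?nnegrE ?cabs_ge0.
  by apply: ler_weXn2l => //; apply: leq_pred.
have h3 : cabs h ^+ 2 * (m%:R * cabs (x ^+ m.-1)) <= cabs h ^+ 2 * (X * (2 * X) ^+ m).
  rewrite ler_wpM2l ?sqr_ge0 //; apply: le_trans h2 _.
  by rewrite -exprMn ler_peMl // exprn_ge0 // mulr_ge0.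
apply: le_trans (lerD h1 h3) _.
by rewrite [_ ^+ m.+1]exprS le_eqVlt; apply/orP; left; apply/eqP; ring.
Qed.

(** Infinite radius of convergence, in a form that can be used directly as a
    geometric domination on the disc of radius X. *)
Definition entire_coef c := forall X : R, 0 <= X ->
  exists C : R, forall m, cabs (c m) * X ^+ m <= C / 2 ^+ m.

Definition power_series c x : K := series_sum (fun m => c m * x ^+ m).

Lemma entire_coef_geom c x : entire_coef c -> exists C, geom_bounded C (fun m => c m * x ^+ m).
Proof.
move=> H; have [C HC] := H _ (cabs_ge0 x); exists C => m.
by rewrite cabsM cabsX.
Qed.

Definition power_series_deriv c x : K := series_sum (fun m => c m * (m%:R * x ^+ m.-1)).

(** The remainder of the sum is the sum of the remainders of the monomials, and
    these are dominated on the disc of radius 2(|x| + 1). *)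
Lemma power_series_is_der c x : entire_coef c -> is_der (power_series c) x (power_series_deriv c x).
Proof.
move=> H; pose X := cabs x + 1.
have X1 : 1 <= X by rewrite /X lerDr cabs_ge0.
have X0 : 0 <= X by apply: le_trans X1.
have [C HC] := H _ (mulr_ge0 (ler0n R 2) X0).
apply: (@quadratic_is_der _ _ _ _ (2 * C)) => h h1.
have [C1 G1] := entire_coef_geom (h + x) H.
have [C2 G2] := entire_coef_geom x H.
have G3 : geom_bounded C (fun m => c m * (m%:R * x ^+ m.-1)).
  move=> m; apply: le_trans (HC m); rewrite !cabsM ler_wpM2l ?cabs_ge0 //.
  rewrite cabs_nat cabsX exprMn ler_pM ?exprn_ge0 ?cabs_ge0 //.
    by rewrite -natrX ler_nat ltnW // ltn_expl.
  apply: le_trans (_ : X ^+ m.-1 <= _).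
    by rewrite lerXn2r ?nnegrE ?cabs_ge0 // /X lerDl.
  by apply: ler_weXn2l => //; apply: leq_pred.
have -> : power_series c (h + x) - power_series c x - h * power_series_deriv c x =
    series_sum (fun m => c m * ((h + x) ^+ m - x ^+ m - h * (m%:R * x ^+ m.-1))).
  rewrite /power_series /power_series_deriv -mulN1r -(series_sumZ (-1) G2)
    -(series_sumD G1 (geom_boundedZ _ G2)).
  rewrite -mulNr -(series_sumZ (- h) G3)
    -(series_sumD (geom_boundedD G1 (geom_boundedZ _ G2)) (geom_boundedZ _ G3)).
  by congr series_sum; apply/funext => m; ring.
rewrite -mulrA [C * _]mulrC; apply: series_sum_bound => m.
rewrite -mulrA; apply: le_trans (_ : cabs h ^+ 2 * (cabs (c m) * (2 * X) ^+ m) <= _).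
  rewrite cabsM [leRHS]mulrCA ler_wpM2l ?cabs_ge0 //; apply: pow_remainder => //.
  by rewrite /X lerD2l.
by rewrite ler_wpM2l ?sqr_ge0.
Qed.

(** Monotonicity beyond some rank bounds the whole sequence; the partial sum is
    a convenient bound for the finitely many first terms. *)
Lemma eventually_le_bounded (u : nat -> R) (N : nat) : (forall m, 0 <= u m) ->
  (forall m, (N <= m)%N -> u m.+1 <= u m) -> exists C, forall m, u m <= C.
Proof.
move=> u0 H; exists (\sum_(m < N.+1) u m) => m.
have hN : u N <= \sum_(m < N.+1) u m.
  by rewrite big_ord_recr /= lerDr sumr_ge0.
have [mN|Nm] := leqP m N; last first.
  rewrite -(subnKC (ltnW Nm)); elim: (m - N)%N => [|j IH]; first by rewrite addn0.
  by rewrite addnS; apply: le_trans IH; apply: H; apply: leq_addr.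
have mN' : (m < N.+1)%N by [].
by rewrite (bigD1 (Ordinal mN')) //= lerDl sumr_ge0.
Qed.

Lemma expr_small (r e : R) : 0 <= r < 1 -> 0 < e ->
  exists N, forall m, (N <= m)%N -> r ^+ m <= e.
Proof.
move=> /andP[r0 r1] e0.
have : (fun m => r ^+ m) @ \oo --> (0 : R) by apply: cvg_expr; rewrite ger0_norm.
move=> /cvgrPdist_lt/(_ _ e0)[N _ HN]; exists N => m Nm.
by have := HN m Nm; rewrite sub0r normrN ger0_norm ?exprn_ge0 // => /ltW.
Qed.

(** The quotient of two consecutive terms is |q|^{m+1} X, which is eventually at
    most 1/2. *)
Lemma entire_coef_theta (q : K) : cabs q < 1 ->
  entire_coef (fun m => (-1) ^+ m * q ^+ 'C(m.+1, 2)).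
Proof.
move=> q1 X X0.
have e0 : 0 < (2 * X + 1)^-1 by rewrite invr_gt0 ltr_wpDl // mulr_ge0.
have [|N HN] := @expr_small (cabs q) _ _ e0; first by rewrite cabs_ge0 q1.
pose u m := cabs ((-1) ^+ m * q ^+ 'C(m.+1, 2)) * X ^+ m * 2 ^+ m.
have uE m : u m = cabs q ^+ 'C(m.+1, 2) * X ^+ m * 2 ^+ m.
  by rewrite /u cabsM !cabsX cabsN cabs1 expr1n mul1r.
have [] := @eventually_le_bounded u N.
- by move=> m; rewrite uE !mulr_ge0 ?exprn_ge0 ?cabs_ge0.
- move=> m Nm; rewrite !uE binS bin1 exprD !exprS.
  set s := cabs q ^+ _; set t := X ^+ m; set v := 2 ^+ m.
  have s0 : 0 <= s * t * v by rewrite !mulr_ge0 ?exprn_ge0 ?cabs_ge0.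
  rewrite (_ : _ * _ = (s * t * v) * (cabs q * cabs q ^+ m * (2 * X))); last by ring.
  rewrite ler_piMr // -exprS.
  apply: le_trans (_ : (2 * X + 1)^-1 * (2 * X) <= _).
    by rewrite ler_wpM2r ?mulr_ge0 // HN // leqW.
  by rewrite ler_pdivrMl ?ltr_wpDl ?mulr_ge0 // mulr1; lra.
move=> C HC; exists C => m.
by rewrite ler_pdivlMr ?exprn_gt0 //; apply: HC.
Qed.

End PowerSeries.

(** * The exponential e(z) *)

Section Exponential.
Variable R : realType.
Local Notation K := (Cplx R).
Implicit Types (z w : K).

Lemma cexpD z w : cexp (z + w) = cexp z * cexp w.
Proof.
case: z w => [a b] [c d]; apply/eqP; rewrite eq_complex /=.
by rewrite expRD cosD sinD; apply/andP; split; apply/eqP; ring.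
Qed.

Lemma cexp0 : cexp (0 : K) = 1.
Proof. by rewrite /cexp /= expR0 cos0 sin0 mulr1 mulr0. Qed.

Lemma e_D z w : e_ (z + w) = e_ z * e_ w.
Proof. by rewrite /e_ mulrDr cexpD. Qed.

Lemma e_0 : e_ (0 : K) = 1.
Proof. by rewrite /e_ mulr0 cexp0. Qed.

Lemma e_neq0 z : e_ z != 0.
Proof.
apply/eqP => H; have := e_D z (- z).
by rewrite subrr e_0 H mul0r => /eqP; rewrite oner_eq0.
Qed.

Lemma e_N z : e_ (- z) = (e_ z)^-1.
Proof.
by apply: (mulfI (e_neq0 z)); rewrite divff ?e_neq0 // -e_D subrr e_0.
Qed.

Lemma e_Mn z (m : nat) : e_ (m%:R * z) = e_ z ^+ m.
Proof.
elim: m => [|m IH]; first by rewrite mul0r e_0.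
by rewrite -natr1 mulrDl mul1r e_D IH exprSr.
Qed.

Lemma e_1 : e_ (1 : K) = 1.
Proof.
by rewrite /e_ mulr1 /cexp /= expR0 !mul1r mulr_natl cos2pi sin2pi.
Qed.

Lemma e_nat (m : nat) : e_ (m%:R : K) = 1.
Proof. by rewrite -[m%:R]mulr1 e_Mn e_1 expr1n. Qed.

Lemma e_int (a : int) : e_ (a%:~R : K) = 1.
Proof. by case: (intP a) => [|m|m]; rewrite ?mulrNz ?e_N ?e_nat ?invr1 // e_0. Qed.

Lemma cabs_e_ z : cabs (e_ z) = expR (- (2 * pi * complex.Im z)).
Proof.
case: z => [x y]; rewrite cabsE /= !mul0r sub0r add0r.
by rewrite !exprMn -mulrDr cos2Dsin2 mulr1 sqrtr_sqr ger0_norm ?expR_ge0.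
Qed.

(** The modulus of e(z) forces z to be real; after subtraction of the integer part,
    cos(2 pi t) = 1 - 2 sin(pi t)^2 with 0 <= t < 1 leaves only t = 0. *)
Lemma e_eq1 z : e_ z = 1 -> exists a : int, z = a%:~R.
Proof.
move=> H; have y0 : complex.Im z = 0.
  have := cabs_e_ z; rewrite H cabs1 -expR0 => /expR_inj/eqP.
  rewrite eq_sym oppr_eq0 mulf_eq0 => /orP[|/eqP//].
  by rewrite gt_eqF ?mulr_gt0 ?pi_gt0.
pose a := Num.floor (complex.Re z); pose t := complex.Re z - a%:~R.
(* Only the fractional part t of z matters, since e is 1 on the integers. *)
have zE : z = a%:~R + ofR t.
  have -> : (a%:~R : K) = ofR a%:~R.
    by case: (intP a) => [|m|m]; rewrite ?mulrNz ?ofRN ?ofR_nat.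
  rewrite -ofRD /t addrC subrK; apply/eqP; rewrite eq_complex /= y0 !eqxx //.
have et : e_ (ofR t) = 1 by move: H; rewrite {1}zE e_D e_int mul1r.
have t0 : 0 <= t by rewrite /t subr_ge0 floor_le_tmp.
have t1 : t < 1 by rewrite /t ltrBlDl -[X in _ < _ + X]/(1%:~R) -intrD1 floorD1_gt.
have [t00|tp] := eqVneq t 0.
  by exists a; rewrite zE t00 ofR0 addr0.
have : cos (pi * t *+ 2) = 1.
  move: et; rewrite /e_ /cexp /= !mul0r mulr0 subr0 add0r expR0 !mul1r => -[+ _].
  by rewrite (_ : 2 * pi * t = pi * t *+ 2) // mulr2n; ring.
rewrite cos_mulr2n; have := cos2Dsin2 (pi * t).
have sp : 0 < sin (pi * t).
  apply: sin_gt0_pi; apply/andP; split; last by rewrite gtr_pMr ?pi_gt0.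
  by rewrite mulr_gt0 ?pi_gt0 // lt_neqAle eq_sym tp.
have := mulr_gt0 sp sp; rewrite -expr2 mulr2n; lra.
Qed.

Lemma real_is_derive (f : R -> R) (l : R) : is_derive (0 : R) (1 : R) f l ->
  forall e : R, 0 < e -> exists2 d, 0 < d &
    forall h, `|h| < d -> `|f h - f 0 - h * l| <= e * `|h|.
Proof.
move=> [fd fl] e e0; move: fd; rewrite /derivable => fd.
have {}fd : h^-1 *: ((f \o shift 0) (h *: 1) - f 0) @[h --> 0^'] --> l.
  by rewrite -fl; exact: fd.
move/cvgrPdist_lt : fd => /(_ _ e0) [d /= d0 Hd]; exists d => // h hd.
have [->|h0] := eqVneq h 0.
  by rewrite subrr mul0r subr0 normr0 mulr0.
have := Hd h; rewrite /= sub0r normrN => /(_ hd h0).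
rewrite /shift /= /GRing.scale /= mulr1 addr0 => H.
rewrite (_ : _ - _ - _ = - (h * (l - h^-1 * (f h - f 0)))); last first.
  by rewrite mulrBr mulVKf // opprB.
by rewrite normrN normrM mulrC ler_wpM2r // ltW.
Qed.

(** With h = x + iy, the two coordinates of exp(h) - 1 - h split into the first
    order remainders of the real functions exp, cos and sin at 0 and the product
    (exp x - 1) y, which is of order two. *)
Lemma cexp_is_der0 : is_der (@cexp R) 0 1.
Proof.
move=> e e0; pose e' := Num.min (8^-1) (e / 8).
have e'0 : 0 < e' by rewrite lt_min invr_gt0 ltr0n divr_gt0 ?ltr0n.
have e'1 : e' <= 8^-1 by rewrite ge_min lexx.
have e'e : e' <= e / 8 by rewrite ge_min lexx orbT.
clearbody e'.
have [d1 d10 H1] := real_is_derive (is_derive_expR (0 : R)) e'0.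
have [d2 d20 H2] := real_is_derive (is_derive_cos (0 : R)) e'0.
have [d3 d30 H3] := real_is_derive (is_derive_sin (0 : R)) e'0.
exists (Num.min (Num.min d1 d2) (Num.min d3 e')).
  by rewrite !lt_min d10 d20 d30 e'0.
move=> h; rewrite !lt_min => /andP[/andP[hd1 hd2] /andP[hd3 he]].
have hx := cabs_Re h; have hy := cabs_Im h.
apply: le_trans (cabs_ReIm _) _; rewrite addr0 cexp0 mulr1.
case: h hx hy hd1 hd2 hd3 he => x y; set n := cabs _ => /= hx hy hd1 hd2 hd3 he.
have := H1 x (le_lt_trans hx hd1); have := H2 y (le_lt_trans hy hd2).
have := H3 y (le_lt_trans hy hd3).
rewrite expR0 cos0 sin0 oppr0 mulr0 !mulr1 !subr0 !addr0.
move: (expR x) (expR_ge0 x) (cos y) (sin y) => E E0 c s.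
rewrite !ler_norml => /andP[s1 s2] /andP[c1 c2] /andP[E1 E2].
set X := `|x| in hx E1 E2; set Y := `|y| in hy c1 c2 s1 s2.
have X0 : 0 <= X := normr_ge0 x. have Y0 : 0 <= Y := normr_ge0 y.
have xX : - X <= x <= X by rewrite -ler_norml.
have yY : - Y <= y <= Y by rewrite -ler_norml.
have EX : e' * X <= X by rewrite ler_piMl //; lra.
have Xe : X <= e' := le_trans hx (ltW he).
have n0 : 0 <= n := le_trans X0 hx.
have E2' : E <= 2 by lra.
have -> : E * c - 1 - x = (E - 1 - x) + E * (c - 1) by ring.
have -> : E * s - y = E * (s - y) + (E - 1) * y by ring.
have b1 : `|E * (c - 1)| <= 2 * (e' * Y).
  by rewrite normrM ler_pM // ?(ger0_norm E0) // ler_norml c1 c2.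
have b2 : `|E * (s - y)| <= 2 * (e' * Y).
  by rewrite normrM ler_pM // ?(ger0_norm E0) // ler_norml s1 s2.
have b3 : `|(E - 1) * y| <= (2 * e') * Y.
  rewrite normrM ler_pM // ler_norml; apply/andP; split; lra.
have b4 : `|E - 1 - x| <= e' * X by rewrite ler_norml E1 E2.
have ee : 8 * e' * n <= e * n.
  by rewrite ler_wpM2r //; lra.
have f1 : e' * X <= e' * n by rewrite ler_wpM2l // ltW.
have f2 : e' * Y <= e' * n by rewrite ler_wpM2l // ltW.
have f0 : 0 <= e' * n by rewrite mulr_ge0 ?(ltW e'0).
have := ler_normD (E - 1 - x) (E * (c - 1)).
have := ler_normD (E * (s - y)) ((E - 1) * y).
lra.
Qed.

(** The addition formula transports the derivative at 0 to any point. *)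
Lemma e_is_der z : is_der (@e_ R) z ((0 +i* (2 * pi))%C * e_ z).
Proof.
move=> e e0; set c : K := (0 +i* (2 * pi))%C.
have c0 : 0 < cabs c.
  rewrite cabs_gt0 eq_complex /= negb_and; apply/orP; right.
  by rewrite mulf_neq0 // gt_eqF // pi_gt0.
have D0 : 0 < cabs (e_ z) * cabs c by rewrite mulr_gt0 // cabs_gt0 e_neq0.
have [d d0 H] := cexp_is_der0 (divr_gt0 e0 D0).
exists (d / cabs c); first by rewrite divr_gt0.
move=> h; rewrite ltr_pdivlMr // mulrC -cabsM => /H.
rewrite addr0 cexp0 mulr1 => {}H.
have -> : e_ (h + z) - e_ z - h * (c * e_ z) = e_ z * (cexp (c * h) - 1 - c * h).
  rewrite e_D -[cexp (c * h)]/(e_ h); ring.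
rewrite cabsM; apply: le_trans (ler_wpM2l (cabs_ge0 _) H) _.
have c1 := lt0r_neq0 c0; have e1 : cabs (e_ z) != 0 by rewrite cabs_eq0 e_neq0.
by rewrite cabsM le_eqVlt; apply/orP; left; apply/eqP; field; rewrite ?c1 ?e1.
Qed.

End Exponential.

(** * The theta function: holomorphy and functional equations *)

Section Theta.
Variable R : realType.
Local Notation K := (Cplx R).
Implicit Types (q z w x eta : K).

Definition theta_coef q (m : nat) : K := (-1) ^+ m * q ^+ 'C(m.+1, 2).

(** The power series A such that theta(z) = A(1/w) - w A(w) for w = e(z): pairing
    the terms m + 1 and - m of the two-sided series makes the exponents of q agree. *)
Definition half_theta q x : K := power_series (theta_coef q) x.

Lemma geom_boundedS (a : nat -> K) C : geom_bounded C a -> geom_bounded C (fun m => a m.+1).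
Proof.
move=> H m; apply: le_trans (H _) _; rewrite ler_wpM2l ?(geom_bounded_ge0 H) //.
by rewrite lef_pV2 ?posrE ?exprn_gt0 // ler_weXn2l // ler1n.
Qed.

Lemma series_sum_recl (a : nat -> K) C : geom_bounded C (fun m => a m.+1) ->
  series_sum a = a 0%N + series_sum (fun m => a m.+1).
Proof.
move=> H1.
have H2 := geom_bounded_cvg H1.
have H3 := cvgD (cvg_cst (a 0%N)) H2.
apply: cvg_series_sum; rewrite -cvg_shiftS.
rewrite (_ : [sequence _]_n = (fun N => a 0%N + series (fun m => a m.+1) N)).
  exact: H3.
by apply/funext => N; rewrite /series /= big_nat_recl.
Qed.

(** The q-difference equation of A, which encodes the quasi-periodicity of theta
    under translation by eta. *)
Lemma half_theta_rec q x : cabs q < 1 -> 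
  half_theta q x = 1 - q * x * half_theta q (q * x).
Proof.
move=> /entire_coef_theta sq; have [C1 G1] := entire_coef_geom x sq.
have [C2 G2] := entire_coef_geom (q * x) sq.
rewrite /half_theta {1}/power_series (series_sum_recl (geom_boundedS G1)).
rewrite /theta_coef bin_small // !expr0 !mul1r.
congr (1 + _); rewrite -mulNr -(series_sumZ _ G2); congr series_sum; apply/funext => m.
rewrite [in LHS]binS bin1 [in LHS]exprD exprMn !exprS; ring.
Qed.

Lemma bin2K (m : nat) : 'C(m.+1, 2)%:R = m%:R * (m%:R + 1) / 2 :> K.
Proof.
elim: m => [|m IH]; first by rewrite bin_small // mul0r mul0r.
by rewrite binS bin1 natrD IH -natr1; field.
Qed.

(** The two halves of the two-sided sum are 1 - w A(w) and A(1/w) - 1. *)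
Lemma theta_half_theta eta z : cabs (e_ eta) < 1 ->
  theta eta z = half_theta (e_ eta) (e_ z)^-1 - e_ z * half_theta (e_ eta) (e_ z).
Proof.
move=> /entire_coef_theta sq; set q := e_ eta; set w := e_ z.
have [C1 G1] := entire_coef_geom w sq; have [C2 G2] := entire_coef_geom w^-1 sq.
have G3 := geom_boundedZ (- w) G1.
have signV m : (-1) ^ (- m.+1%:Z) = (-1) ^+ m.+1 :> K.
  by rewrite -exprnN -exprVn invrN1.
pose up m : K := (-1) ^ m%:Z * e_ (m%:~R * z + m%:~R * (m%:~R - 1) / 2 * eta).
pose un m : K := (-1) ^ (- m.+1%:Z) *
    e_ ((- m.+1%:Z)%:~R * z + (- m.+1%:Z)%:~R * ((- m.+1%:Z)%:~R - 1) / 2 * eta).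
have up0 : up 0%N = 1 by rewrite /up mul0r !mul0r addr0 e_0 mulr1.
have upS m : up m.+1 = - w * (theta_coef q m * w ^+ m).
  rewrite /up /theta_coef e_D e_Mn -[q ^+ _]e_Mn bin2K -exprnP.
  rewrite (_ : m.+1%:~R * (m.+1%:~R - 1) / 2 = m%:R * (m%:R + 1) / 2 :> K).
    by rewrite -/w !exprS; ring.
  by rewrite -natr1; ring.
have unS m : un m = theta_coef q m.+1 * w^-1 ^+ m.+1.
  rewrite /un /theta_coef signV e_D -[q ^+ _]e_Mn bin2K mulrNz mulNr e_N e_Mn.
  rewrite (_ : - m.+1%:R * (- m.+1%:R - 1) / 2 = m.+1%:R * (m.+1%:R + 1) / 2 :> K).
    by rewrite exprVn -/w; ring.
  by ring.
have pos : series_sum up = 1 - w * half_theta q w.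
  have G4 : geom_bounded (cabs (- w) * C1) (fun m => up m.+1).
    by move=> m; rewrite upS; apply: G3.
  rewrite (series_sum_recl G4) up0 -mulNr -(series_sumZ _ G1); congr (_ + series_sum _).
  by apply/funext => m; rewrite upS.
have neg : series_sum un = half_theta q w^-1 - 1.
  rewrite [in RHS]/half_theta /power_series (series_sum_recl (geom_boundedS G2)).
  rewrite bin_small // !expr0 !mul1r addrAC subrr add0r; congr series_sum; apply/funext => m.
  exact: unS.
transitivity (series_sum up + series_sum un).
  rewrite /theta /sumZ /series_sum /up /un; congr (_ + _).
rewrite pos neg -/q -/w.
move: (half_theta q w) (half_theta q w^-1) => A B.
by rewrite addrC addrA subrK.
Qed.

Lemma theta_opp eta z : cabs (e_ eta) < 1 ->
  theta eta (- z) = - e_ (- z) * theta eta z.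
Proof.
move=> q1; rewrite !(theta_half_theta _ q1) e_N invrK.
have w0 := e_neq0 z; move: (e_ z) w0 => w w0.
move: (half_theta _ w) (half_theta _ w^-1) => A B.
by field; rewrite w0.
Qed.

Lemma theta_add1 eta z : cabs (e_ eta) < 1 -> theta eta (z + 1) = theta eta z.
Proof. by move=> q1; rewrite !(theta_half_theta _ q1) e_D e_1 mulr1. Qed.

(** Both values of A at the translated arguments are rewritten by its q-difference
    equation, and the constants 1 cancel. *)
Lemma theta_addeta eta z : cabs (e_ eta) < 1 ->
  theta eta (z + eta) = - e_ (- z) * theta eta z.
Proof.
move=> q1; rewrite !(theta_half_theta _ q1) e_D e_N.
set q := e_ eta; set w := e_ z.
have q0 : q != 0 := e_neq0 _. have w0 : w != 0 := e_neq0 _.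
have h1 := half_theta_rec (w * q)^-1 q1.
have h2 := half_theta_rec w q1.
rewrite -/q in h1 h2.
have qw : q * (w * q)^-1 = w^-1 by field; rewrite q0 w0.
rewrite qw in h1; rewrite h1.
have h3 : w * q * half_theta q (w * q) = 1 - half_theta q w.
  by rewrite h2 [w * q]mulrC; ring.
rewrite h3; move: (half_theta q w) (half_theta q w^-1) => A B.
by field; rewrite w0.
Qed.

Lemma theta0 eta : cabs (e_ eta) < 1 -> theta eta 0 = 0.
Proof. by move=> q1; rewrite (theta_half_theta _ q1) e_0 invr1 mul1r subrr. Qed.

End Theta.

Section Holomorphic.
Variable R : realType.
Local Notation K := (Cplx R).
Implicit Types (f g : K -> K).

Definition holo f := forall z : K, derivable f z 1.

Lemma holo_comp f g : holo f -> holo g -> holo (fun z => f (g z)).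
Proof.
move=> hf hg z; apply/derivable1_diffP.
by apply: (@differentiable_comp _ _ _ _ g f); apply/derivable1_diffP.
Qed.

Lemma holo_id : holo id. Proof. by move=> z; apply: derivable_id. Qed.
Lemma holo_cst (c : K) : holo (fun=> c). Proof. by move=> z; apply: derivable_cst. Qed.
Lemma holoD f g : holo f -> holo g -> holo (fun z => f z + g z).
Proof. by move=> hf hg z; apply: (derivableD (hf z) (hg z)). Qed.
Lemma holoM f g : holo f -> holo g -> holo (fun z => f z * g z).
Proof. by move=> hf hg z; apply: (derivableM (hf z) (hg z)). Qed.
Lemma holoN f : holo f -> holo (fun z => - f z).
Proof. by move=> hf z; apply: (derivableN (hf z)). Qed.
Lemma holo_prod (I : Type) (s : seq I) (P : pred I) (F : I -> K -> K) :
  (forall i, holo (F i)) -> holo (fun z => \prod_(i <- s | P i) F i z).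
Proof.
move=> H; elim: s => [|i s IH].
  rewrite (_ : (fun _ => _) = (fun=> 1)); first exact: holo_cst.
  by apply/funext => z; rewrite big_nil.
rewrite (_ : (fun _ => _) =
  (fun z => (if P i then F i z else 1) * \prod_(j <- s | P j) F j z)).
  apply: holoM; last exact: IH.
  by case: (P i); [exact: H|exact: holo_cst].
by apply/funext => z; rewrite big_cons; case: (P i); rewrite ?mul1r.
Qed.

Lemma holo_e : holo (@e_ R).
Proof. by move=> z; apply: is_der_derivable; apply: e_is_der. Qed.

Lemma holo_theta (eta : K) : cabs (e_ eta) < 1 -> holo (theta eta).
Proof.
move=> q1.
have hA : holo (half_theta (e_ eta)).
  by move=> z; apply: is_der_derivable; apply/power_series_is_der/entire_coef_theta.
rewrite (_ : theta eta = (fun z => half_theta (e_ eta) (e_ (- z)) +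
    - (e_ z * half_theta (e_ eta) (e_ z)))).
  have he := holo_e.
  exact: (holoD (holo_comp hA (holo_comp he (holoN holo_id)))
           (holoN (holoM he (holo_comp hA he)))).
by apply/funext => z; rewrite (theta_half_theta _ q1) e_N.
Qed.

End Holomorphic.

(** * The q-binomial theorem and the finite Jacobi triple product *)

Section QBinomial.
Variable (F : fieldType) (q : F).

(** Gaussian binomial coefficients, by the q-Pascal rule. *)
Fixpoint qbinom (n k : nat) : F :=
  match k, n with
  | 0, _ => 1
  | _.+1, 0 => 0
  | k'.+1, n'.+1 => q ^+ k * qbinom n' k + qbinom n' k'
  end.

(** The q-Pochhammer symbol (q;q)_n. *)
Definition qpoch (n : nat) : F := \prod_(i < n) (1 - q ^+ i.+1).

Lemma qbinomn0 n : qbinom n 0 = 1. Proof. by case: n. Qed.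

Lemma qbinom_small n k : (n < k)%N -> qbinom n k = 0.
Proof.
elim: n k => [|n IH] [|k] //= nk.
by rewrite !IH ?mulr0 ?addr0 // ltnW.
Qed.

Lemma qpochS n : qpoch n.+1 = qpoch n * (1 - q ^+ n.+1).
Proof. by rewrite /qpoch big_ord_recr. Qed.

Lemma qbinom_qpoch n k : (k <= n)%N ->
  qbinom n k * qpoch k * qpoch (n - k) = qpoch n.
Proof.
elim: n k => [|n IH] [|k] //.
- by move=> _; rewrite /= /qpoch big_ord0 !mulr1.
- by move=> _; rewrite subn0 qbinomn0 /qpoch big_ord0 !mul1r.
rewrite ltnS subSS => kn /=.
have H1 := IH _ kn; rewrite !qpochS.
move: kn; rewrite leq_eqVlt => /orP[/eqP ->|kn].
  rewrite qbinom_small // mulr0 add0r subnn.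
  have := IH n (leqnn n); rewrite subnn => E; by rewrite mulrA mulrAC E.
have H2 := IH _ kn; rewrite qpochS in H2.
have nk : (n - k = (n - k.+1).+1)%N by lia.
rewrite nk qpochS in H1 *.
have -> : q ^+ n.+1 = q ^+ k.+1 * q ^+ (n - k.+1).+1.
  by rewrite -exprD; congr (_ ^+ _); lia.
move: H1 H2; move: (qpoch (n - k.+1)) (q ^+ (n - k.+1).+1) (q ^+ k.+1) => Q t s.
move: (qpoch k) (qpoch n) (qbinom n k) (qbinom n k.+1) => P W g g' H1 H2.
transitivity (s * (1 - t) * (g' * (P * (1 - s)) * Q) + (1 - s) * (g * P * (Q * (1 - t)))).
  by ring.
by rewrite H1 H2; ring.
Qed.

(** Induction on n: the factor j = 0 is split off and x is replaced by xq in the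
    others; comparing coefficients of x^k is the q-Pascal rule. *)
Lemma qbinom_thm x n : \prod_(j < n) (1 + x * q ^+ j) =
  \sum_(k < n.+1) q ^+ 'C(k, 2) * qbinom n k * x ^+ k.
Proof.
elim: n x => [|n IH] x.
  by rewrite big_ord0 big_ord_recl big_ord0 bin_small // !expr0 !mulr1 addr0.
rewrite big_ord_recl expr0 mulr1.
rewrite (eq_bigr (fun j : 'I_n => 1 + (x * q) * q ^+ j)); last first.
  by move=> j _; rewrite lift0 exprS mulrA.
rewrite IH mulrDl mul1r.
rewrite [RHS]big_ord_recl qbinomn0 bin_small // !expr0 !mulr1.
pose f k := q ^+ 'C(k.+1, 2) * (q ^+ k.+1 * qbinom n k.+1) * x ^+ k.+1.
pose g k := q ^+ 'C(k.+1, 2) * qbinom n k * x ^+ k.+1.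
rewrite [in RHS](eq_bigr (fun i : 'I_n.+1 => f i + g i)); last first.
  by move=> i _; rewrite lift0 /= /f /g; ring.
rewrite big_split /= addrA; congr (_ + _).
  rewrite big_ord_recl [in RHS]big_ord_recr /= /f [qbinom n n.+1]qbinom_small //.
  rewrite qbinomn0 bin_small // !expr0 !mulr1 !mulr0 mul0r addr0.
  by congr (_ + _); apply: eq_bigr => i _; rewrite /bump leq0n add1n exprMn; ring.
rewrite mulr_sumr; apply: eq_bigr => i _.
by rewrite /g binS bin1 exprD exprMn exprS; ring.
Qed.

Lemma prod_qpow N : \prod_(i < N) q ^+ i.+1 = q ^+ 'C(N.+1, 2).
Proof.
elim: N => [|N IH]; first by rewrite big_ord0 bin_small.
by rewrite big_ord_recr /= IH -exprD [in RHS]binS bin1.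
Qed.

Lemma bin2_identity1 m l :
  ('C(l, 2) + 'C((m + l).+1, 2) = 'C(m.+1, 2) + (m + l) * l)%N.
Proof.
elim: l => [|l IH]; first by rewrite addn0 muln0 addn0 bin0n.
rewrite addnS (binS l) (binS (m + l).+1) !bin1; nia.
Qed.

Lemma bin2_identity2 N m :
  ('C(N.+1 + m, 2) + 'C(N.+1, 2) = 'C(m.+1, 2) + N * (N.+1 + m))%N.
Proof.
elim: m => [|m IH]; last first.
  by rewrite addnS (binS (N.+1 + m)) (binS m.+1) !bin1; nia.
rewrite addn0 [in RHS]bin_small // add0n.
by elim: N => // N IH; rewrite binS bin1; lia.
Qed.

(** The q-binomial theorem with 2N + 1 factors at x = - w / q^N.  The factors of
    index less than N are turned over, each at the price of a monomial, and the
    terms of index N - m and N + 1 + m are grouped: they share their q-binomial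
    coefficient and their power of q. *)
Lemma finite_jacobi (w : F) (N : nat) : q != 0 -> w != 0 ->
  (forall n, qpoch n != 0) ->
  \prod_(j < N.+1) (1 - w * q ^+ j) * \prod_(j < N) (1 - w^-1 * q ^+ j.+1) =
  \sum_(m < N.+1) qpoch (N + N.+1) / (qpoch (N - m) * qpoch (N.+1 + m)) *
    ((-1) ^+ m * q ^+ 'C(m.+1, 2)) * (w^-1 ^+ m - w ^+ m.+1).
Proof.
move=> q0 w0 qp.
have qX n : q ^+ n != 0 by rewrite expf_neq0.
have N1w : - w != 0 by rewrite oppr_eq0.
(* A collects the monomials that come out when the first N factors are
   turned over. *)
pose x := - w / q ^+ N; pose A := (- w) ^+ N / q ^+ 'C(N.+1, 2).
have A0 : A != 0 by rewrite mulf_neq0 ?expf_neq0 // invr_eq0.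
apply: (mulfI A0).
transitivity (\prod_(j < N + N.+1) (1 + x * q ^+ j)).
  rewrite big_split_ord /= mulrCA mulrC; congr (_ * _); last first.
    by apply: eq_bigr => i _; rewrite exprD /x; field.
  rewrite [RHS](reindex_inj rev_ord_inj) /= /A -prod_qpow.
  rewrite (_ : (- w) ^+ N = \prod_(i < N) (- w)); last by rewrite prodr_const card_ord.
  rewrite -prodf_div -big_split /=.
  apply: eq_bigr => i _; rewrite /x.
  have -> : q ^+ N = q ^+ (N - i.+1) * q ^+ i.+1 by rewrite -exprD subnK.
  by field; rewrite w0 !qX.
rewrite qbinom_thm -[(N + N.+1).+1]/(N.+1 + N.+1)%N big_split_ord /= mulr_sumr.
rewrite [X in X + _](reindex_inj rev_ord_inj) /= -big_split; apply: eq_bigr => i _ /=.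
have iN : (i <= N)%N by rewrite -ltnS.
rewrite subSS.
have E1 : qbinom (N + N.+1) (N - i) =
   qpoch (N + N.+1) / (qpoch (N - i) * qpoch (N.+1 + i)).
  have := @qbinom_qpoch (N + N.+1) (N - i) ltac:(lia).
  rewrite (_ : (N + N.+1 - (N - i))%N = (N.+1 + i)%N); last by lia.
  by move=> <-; field; rewrite !qp.
have E2 : qbinom (N + N.+1) (N.+1 + i) =
   qpoch (N + N.+1) / (qpoch (N - i) * qpoch (N.+1 + i)).
  have := @qbinom_qpoch (N + N.+1) (N.+1 + i) ltac:(lia).
  rewrite (_ : (N + N.+1 - (N.+1 + i))%N = (N - i)%N); last by lia.
  by move=> <-; field; rewrite !qp.
rewrite E1 E2; move: (_ / _) => g.
have B1 : A * ((-1) ^+ i * q ^+ 'C(i.+1, 2)) * w^-1 ^+ i = q ^+ 'C(N - i, 2) * x ^+ (N - i).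
  rewrite /A /x.
  have := bin2_identity1 i (N - i); rewrite subnKC // => E.
  have {E}EE : q ^+ 'C(N - i, 2) * q ^+ 'C(N.+1, 2) =
    q ^+ 'C(i.+1, 2) * (q ^+ N) ^+ (N - i) by rewrite -!exprD E exprD exprM.
  have -> : (- w) ^+ N = (-1) ^+ i * w ^+ i * (- w) ^+ (N - i).
    by rewrite -exprMn mulN1r -exprD subnKC.
  have s2 : (-1) ^+ i * (-1) ^+ i = 1 :> F by rewrite -exprD addnn -mul2n exprM sqrrN expr1n expr1n.
  have EE2 : q ^+ 'C(N - i, 2) = q ^+ 'C(i.+1, 2) * (q ^+ N) ^+ (N - i) / q ^+ 'C(N.+1, 2).
    by rewrite -EE mulfK.
  rewrite EE2 exprMn !exprVn.
  rewrite (_ : _ * w ^- i = ((-1) ^+ i * (-1) ^+ i) * (- w) ^+ (N - i) *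
      q ^+ 'C(i.+1, 2) / q ^+ 'C(N.+1, 2)).
    by rewrite s2; field; rewrite !expf_neq0.
  by field; rewrite !expf_neq0.
have B2 : A * ((-1) ^+ i * q ^+ 'C(i.+1, 2)) * - w ^+ i.+1 =
    q ^+ 'C(N.+1 + i, 2) * x ^+ (N.+1 + i).
  rewrite /A /x.
  have E := bin2_identity2 N i.
  have {E}EE : q ^+ 'C(N.+1 + i, 2) * q ^+ 'C(N.+1, 2) =
    q ^+ 'C(i.+1, 2) * (q ^+ N) ^+ (N.+1 + i) by rewrite -!exprD E exprD exprM.
  have EE2 : q ^+ 'C(N.+1 + i, 2) =
     q ^+ 'C(i.+1, 2) * (q ^+ N) ^+ (N.+1 + i) / q ^+ 'C(N.+1, 2).
    by rewrite -EE mulfK.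
  have E3 : (- w) ^+ (N.+1 + i) = (- w) ^+ N * - ((-1) ^+ i * w ^+ i.+1).
    rewrite addSn -addnS exprD; congr (_ * _).
    by rewrite -[in LHS](mulN1r w) exprMn [in (-1) ^+ i.+1]exprS; ring.
  rewrite EE2 exprMn !exprVn E3.
  by field; rewrite !expf_neq0.
rewrite (_ : A * _ = g * (A * ((-1) ^+ i * q ^+ 'C(i.+1, 2)) * w^-1 ^+ i) +
  g * (A * ((-1) ^+ i * q ^+ 'C(i.+1, 2)) * - w ^+ i.+1)); last by ring.
by rewrite B1 B2; ring.
Qed.

End QBinomial.

(** * The zeros of theta *)

Section Nonvanishing.
Variable R : realType.
Local Notation K := (Cplx R).
Implicit Types (q z w eta : K) (x : nat -> K) (C r : R).

Lemma geom_sum_le C r n : 0 <= C -> 0 <= r < 1 ->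
  \sum_(j < n) C * r ^+ j <= C / (1 - r).
Proof.
move=> C0 /andP[r0 r1].
have -> : \sum_(j < n) C * r ^+ j = C * (1 - r ^+ n) / (1 - r).
  elim: n => [|n IH]; first by rewrite big_ord0 expr0 subrr mulr0 mul0r.
  by rewrite big_ord_recr /= IH exprS; field; rewrite subr_eq0 gt_eqF.
rewrite ler_wpM2r ?invr_ge0 ?subr_ge0 ?(ltW r1) //.
by rewrite ler_piMr // gerBl exprn_ge0.
Qed.

(** From |1 - x| <= 1 + |x| <= exp |x|. *)
Lemma prod_upper x C r : 0 <= r < 1 -> (forall j, cabs (x j) <= C * r ^+ j) ->
  forall n, cabs (\prod_(j < n) (1 - x j)) <= expR (C / (1 - r)).
Proof.
move=> r01 H n; have C0 : 0 <= C.
  by have := H 0%N; rewrite expr0 mulr1; apply: le_trans; apply: cabs_ge0.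
apply: le_trans (_ : expR (\sum_(j < n) C * r ^+ j) <= _); last first.
  by rewrite ler_expR geom_sum_le.
rewrite cabs_prod; elim: n => [|n IH]; first by rewrite !big_ord0 expR0.
rewrite !big_ord_recr /= expRD ler_pM ?cabs_ge0 ?prodr_ge0 //.
  by move=> i _; apply: cabs_ge0.
apply: le_trans (cabsD _ _) _; rewrite cabs1 cabsN.
by apply: le_trans (expR_ge1Dx _); rewrite lerD2l.
Qed.

Lemma prod_lower_small (x : nat -> K) (t : nat -> R) n :
  (forall j, cabs (x j) <= t j) -> \sum_(j < n) t j <= 1 ->
  1 - \sum_(j < n) t j <= cabs (\prod_(j < n) (1 - x j)).
Proof.
move=> H; have t0 j : 0 <= t j by apply: le_trans (H j); apply: cabs_ge0.
elim: n => [|n IH]; first by rewrite !big_ord0 subr0 cabs1.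
rewrite !big_ord_recr /= cabsM => S1.
have S0 : 0 <= \sum_(j < n) t j by apply: sumr_ge0.
have {}IH := IH ltac:(have := t0 n; lra).
have h : 1 - t n <= cabs (1 - x n).
  by apply: le_trans (cabsB _ _); rewrite cabs1 lerD2l lerN2.
have t1 : 0 <= 1 - t n by lra.
have S2 : 0 <= 1 - \sum_(j < n) t j by have := t0 n; lra.
apply: le_trans (ler_pM S2 t1 IH h).
have := mulr_ge0 S0 (t0 n); lra.
Qed.

Lemma finite_lower (u : nat -> R) M : (forall n, 0 < u n) ->
  exists2 b, 0 < b & forall n, (n <= M)%N -> b <= u n.
Proof.
move=> u0; elim: M => [|M [b b0 Hb]].
  by exists (u 0%N) => // n; rewrite leqn0 => /eqP ->.
exists (Num.min b (u M.+1)); first by rewrite lt_min b0 u0.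
move=> n; rewrite leq_eqVlt => /orP[/eqP ->|]; first by rewrite ge_min lexx orbT.
by rewrite ltnS => /Hb; rewrite ge_min => ->.
Qed.

(** A tail of the product is at least 1/2 because the tail of the geometric series
    is small, and only finitely many partial products, all non-zero, remain. *)
Lemma prod_lower x C r : 0 <= r < 1 -> (forall j, cabs (x j) <= C * r ^+ j) ->
  (forall j, x j != 1) ->
  exists2 b, 0 < b & forall n, b <= cabs (\prod_(j < n) (1 - x j)).
Proof.
move=> r01 H x1; have C0 : 0 <= C.
  by have := H 0%N; rewrite expr0 mulr1; apply: le_trans; apply: cabs_ge0.
have r1 : 0 < 1 - r by case/andP: r01 => _; rewrite subr_gt0.
have e0 : 0 < (1 - r) / (2 * (C + 1)) by rewrite divr_gt0 // mulr_gt0 // ltr_wpDl //.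
have [M HM] := expr_small r01 e0.
have rM : C * r ^+ M / (1 - r) <= 2^-1.
  have := HM _ (leqnn M); rewrite ler_pdivlMr; last by rewrite mulr_gt0 // ltr_wpDl //.
  rewrite ler_pdivrMr // => h; have : 0 <= r ^+ M by rewrite exprn_ge0 //; case/andP: r01.
  lra.
have [|b b0 Hb] := @finite_lower (fun n => cabs (\prod_(j < n) (1 - x j))) M.
  move=> n; rewrite cabs_gt0; apply/prodf_neq0 => i _.
  by rewrite subr_eq0 eq_sym.
exists (b / 2); first by rewrite divr_gt0.
move=> n; have [nM|Mn] := leqP n M.
  by apply: le_trans (Hb n nM); lra.
rewrite -(subnKC (ltnW Mn)) big_split_ord /= cabsM.
have tl : 2^-1 <= cabs (\prod_(i < n - M) (1 - x (M + i)%N)).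
  have Ht j : cabs (x (M + j)%N) <= C * r ^+ M * r ^+ j.
    by rewrite -mulrA -exprD.
  have S := @geom_sum_le (C * r ^+ M) r (n - M).
  have {}S := S (mulr_ge0 C0 (exprn_ge0 _ _)) r01.
  have {}S := le_trans (S ltac:(by case/andP: r01)) rM.
  have := prod_lower_small (x := fun j => x (M + j)%N) Ht; move/(_ (n - M)%N).
  lra.
by rewrite ler_pM ?invr_ge0 ?(ltW b0) // Hb.
Qed.

End Nonvanishing.

Section Zeros.
Variable R : realType.
Local Notation K := (Cplx R).
Implicit Types (q z w eta : K).

Lemma qpoch_bounds q : cabs q < 1 -> exists b B : R,
  [/\ 0 < b, forall n, b <= cabs (qpoch q n) & forall n, cabs (qpoch q n) <= B].
Proof.
move=> q1; have r01 : 0 <= cabs q < 1 by rewrite cabs_ge0.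
have H j : cabs (q ^+ j.+1) <= 1 * cabs q ^+ j.
  by rewrite mul1r cabsX exprSr ler_piMr ?exprn_ge0 ?cabs_ge0 // ltW.
have x1 j : q ^+ j.+1 != 1.
  apply/eqP => E; have : cabs (q ^+ j.+1) < 1 by rewrite cabsX exprn_ilt1 ?cabs_ge0.
  by rewrite E cabs1 ltxx.
have [b b0 Hb] := prod_lower r01 H x1.
by exists b, (expR (1 / (1 - cabs q))); split=> // n; apply: (prod_upper r01 H).
Qed.

(** The difference (q;q)_i - (q;q)_n telescopes into terms (q;q)_l q^{l+1}, which
    are summed as a geometric series. *)
Lemma qpoch_ratio q (b B : R) : cabs q < 1 -> 0 < b ->
  (forall n, b <= cabs (qpoch q n)) -> (forall n, cabs (qpoch q n) <= B) ->
  forall i n, (i <= n)%N ->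
    cabs (1 - qpoch q n / qpoch q i) <= B / (b * (1 - cabs q)) * cabs q ^+ i.
Proof.
move=> q1 b0 Hb HB i n iN; set r := cabs q in q1 *.
have r0 : 0 <= r := cabs_ge0 q.
have B0 : 0 <= B by apply: le_trans (HB 0%N); apply: cabs_ge0.
have p0 : qpoch q i != 0 by rewrite -cabs_gt0; apply: lt_le_trans (Hb i).
have -> : 1 - qpoch q n / qpoch q i = (qpoch q i - qpoch q n) / qpoch q i by field.
have D : cabs (qpoch q i - qpoch q n) <= \sum_(j < n - i) B * r ^+ i * r ^+ j.
  rewrite -(subnKC iN); elim: (n - i)%N => [|l IH].
    by rewrite addn0 subrr cabs0 subnn big_ord0.
  rewrite addKn in IH; rewrite addKn big_ord_recr /= addnS qpochS.
  rewrite (_ : _ - _ = (qpoch q i - qpoch q (i + l)) +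
     qpoch q (i + l) * q ^+ (i + l).+1); last by ring.
  apply: le_trans (cabsD _ _) _; rewrite lerD // cabsM cabsX -/r -mulrA -exprD.
  rewrite ler_pM ?cabs_ge0 ?exprn_ge0 // exprS ler_piMl ?exprn_ge0 //; exact: ltW.
have r01 : 0 <= r < 1 by rewrite r0.
have S := le_trans D (geom_sum_le (n - i) (mulr_ge0 B0 (exprn_ge0 i r0)) r01).
rewrite cabsM cabsV; apply: le_trans (_ : B * r ^+ i / (1 - r) * b^-1 <= _).
  by rewrite ler_pM ?invr_ge0 ?cabs_ge0 // lef_pV2 // posrE // cabs_gt0.
have b1 : b != 0 := lt0r_neq0 b0.
have r1 : 1 - r != 0 by rewrite subr_eq0 gt_eqF.
by rewrite le_eqVlt; apply/orP; left; apply/eqP; field; rewrite b1 r1.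
Qed.

Definition jacobi_prod q w N : K :=
  \prod_(j < N.+1) (1 - w * q ^+ j) * \prod_(j < N) (1 - w^-1 * q ^+ j.+1).

(** Multiplied by (q;q)_N, the coefficient of index m in the finite triple product
    differs from 1 by at most k |q|^{N-m}, both for m <= N, by the two ratios of
    q-Pochhammer symbols that it contains, and for m > N, where it is 0.  The
    factor |q|^{-m} is then absorbed by the fast decay of the terms of theta. *)
Lemma theta_jacobi eta z : cabs (e_ eta) < 1 -> exists C : R, forall N,
  cabs (theta eta z - qpoch (e_ eta) N * jacobi_prod (e_ eta) (e_ z) N)
    <= C * cabs (e_ eta) ^+ N.
Proof.
move=> q1; rewrite (theta_half_theta z q1); set q := e_ eta in q1 *; set w := e_ z.
have w0 : w != 0 := e_neq0 z. have q0 : q != 0 := e_neq0 eta.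
have [b [B [b0 Hb HB]]] := qpoch_bounds q1.
have qp0 n : qpoch q n != 0 by rewrite -cabs_gt0; apply: lt_le_trans (Hb n).
have HE := qpoch_ratio q1 b0 Hb HB.
set r := cabs q in q1 HE *; have r0 : 0 < r by rewrite cabs_gt0.
set k1 := B / _ in HE.
have B0 : 0 <= B by apply: le_trans (HB 0%N); apply: cabs_ge0.
have k10 : 0 <= k1.
  by rewrite /k1 divr_ge0 // mulr_ge0 ?(ltW b0) // subr_ge0 ltW.
pose k := k1 + B / b * k1 + 1.
have k0 : 0 <= k by rewrite /k !addr_ge0 // mulr_ge0 // divr_ge0 // ltW.
have sq := entire_coef_theta q1.
have [C1 G1] := entire_coef_geom w^-1 sq; have [C2 G2] := entire_coef_geom w sq.
pose a m := theta_coef q m * w^-1 ^+ m + - w * (theta_coef q m * w ^+ m).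
have Ga : half_theta q w^-1 - w * half_theta q w = series_sum a.
  by rewrite (series_sumD G1 (geom_boundedZ (- w) G2)) (series_sumZ (- w) G2) mulNr.
have cva : series a @ \oo --> series_sum a :=
  geom_bounded_cvg (geom_boundedD G1 (geom_boundedZ (- w) G2)).
rewrite Ga.
have ri0 : 0 <= r^-1 by rewrite invr_ge0 ltW.
have [C1' H1] := sq _ (mulr_ge0 (cabs_ge0 w^-1) ri0).
have [C2' H2] := sq _ (mulr_ge0 (cabs_ge0 w) ri0).
pose C := C1' + cabs w * C2'.
have aE m : a m = theta_coef q m * (w^-1 ^+ m - w ^+ m.+1).
  by rewrite /a [w ^+ m.+1]exprS; ring.
have Ha m : cabs (a m) * r^-1 ^+ m <= C / 2 ^+ m.
  have h1 := H1 m; have h2 := H2 m.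
  rewrite /C mulrDl; apply: le_trans (lerD h1 (_ : cabs w * _ <= _)); last first.
    by rewrite -mulrA ler_wpM2l ?cabs_ge0 //; exact: h2.
  rewrite !exprMn !mulrA -mulrDl ler_wpM2r ?exprn_ge0 ?invr_ge0 ?(ltW r0) //.
  apply: le_trans (cabsD _ _) _; rewrite -!cabsX -!cabsM -[theta_coef q m]/(_ * _).
  rewrite lerD //; rewrite mulNr cabsN mulrA; exact: lexx.
have C0 : 0 <= C.
  have := Ha 0%N; rewrite !expr0 mulr1 divr1; apply: le_trans; exact: cabs_ge0.
pose g N m : K := qpoch q N * (qpoch q (N + N.+1) / (qpoch q (N - m) * qpoch q (N.+1 + m))).
(* The defect of the m-th coefficient, after multiplication by (q;q)_N. *)
pose d N m : K := if (m < N.+1)%N then 1 - g N m else 1.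
have Hd N m : cabs (d N m) <= k * (r ^+ N * r^-1 ^+ m).
  rewrite /d; case: ifP => [|/negbT]; rewrite ltnS.
    move=> mN.
    have -> : r ^+ N * r^-1 ^+ m = r ^+ (N - m).
      rewrite -{1}(subnK mN) exprD exprVn mulfK //.
      by rewrite expf_neq0 // gt_eqF.
    set E1 := qpoch q N / qpoch q (N - m).
    set E2 := qpoch q (N + N.+1) / qpoch q (N.+1 + m).
    have h1 : cabs (1 - E1) <= k1 * r ^+ (N - m) by apply: HE; apply: leq_subr.
    have h2 : cabs (1 - E2) <= k1 * r ^+ (N - m).
      apply: le_trans (HE (N.+1 + m)%N _ _) _; first by rewrite addnC leq_add2r.
      rewrite ler_wpM2l // ler_wiXn2l ?(ltW r0) ?(ltW q1) //.
      exact: leq_trans (leq_subr m N) (leq_trans (leqnSn N) (leq_addr _ _)).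
    have h3 : cabs E1 <= B / b.
      rewrite cabsM cabsV ler_pM ?invr_ge0 ?cabs_ge0 // lef_pV2 // posrE //.
      by apply: lt_le_trans (Hb _).
    (* The coefficient is a product of two ratios, each close to 1. *)
    have -> : 1 - g N m = (1 - E1) + E1 * (1 - E2).
      by rewrite /g /E1 /E2; field; rewrite !qp0.
    apply: le_trans (cabsD _ _) _; rewrite cabsM /k.
    have h4 := ler_pM (cabs_ge0 _) (cabs_ge0 _) h3 h2.
    have h5 : 0 <= r ^+ (N - m) by rewrite exprn_ge0 ?ltW.
    lra.
  rewrite -ltnNge => Nm; rewrite cabs1.
  have h1 : 1 <= r ^+ N * r^-1 ^+ m.
    rewrite -(subnK (ltnW Nm)) exprD [r^-1 ^+ N]exprVn mulrCA divff ?mulr1.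
      by rewrite exprn_ege1 // invf_ge1 // ltW.
    by rewrite expf_neq0 // gt_eqF.
  apply: le_trans h1 _; rewrite ler_peMl //.
    by rewrite mulr_ge0 ?exprn_ge0 ?invr_ge0 ?ltW.
  by rewrite /k lerDr addr_ge0 // mulr_ge0 // divr_ge0 // ltW.
exists (2 * (k * C)) => N.
set P := qpoch q N * _.
have cvP : (fun M => series a M - P) @ \oo --> series_sum a - P .
  by apply: (cvgB cva (cvg_cst P)).
apply: (cabs_lim_le cvP); near=> M.
have NM : (N.+1 <= M)%N by near: M; exists N.+1.
rewrite /=; have -> : series a M - P = \sum_(m < M) d N m * a m.
  rewrite /P /jacobi_prod (finite_jacobi N q0 w0 qp0) mulr_sumr /series /=.
  rewrite big_mkord.
  rewrite (eq_bigr (fun m : 'I_N.+1 => g N m * a m)); last first.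
    by move=> m _; rewrite aE /g /theta_coef; ring.
  rewrite (big_ord_widen M (fun m => g N m * a m) NM) [X in _ - X]big_mkcond -sumrB.
  apply: eq_bigr => m _; rewrite /d; case: ifP => _; first by ring.
  by rewrite subr0 mul1r.
apply: le_trans (cabs_sum _ _ _) _.
apply: le_trans (_ : \sum_(m < M) k * r ^+ N * C / 2 ^+ m <= _).
  apply: ler_sum => m _; rewrite cabsM.
  apply: le_trans (ler_wpM2r (cabs_ge0 _) (Hd N m)) _.
  rewrite -!mulrA ler_wpM2l // ler_wpM2l ?exprn_ge0 ?(ltW r0) // mulrC.
  exact: Ha.
apply: le_trans (geom_half_sum_le _ _) _.
  by rewrite mulr_ge0 // mulr_ge0 // exprn_ge0 // ltW.
by rewrite le_eqVlt; apply/orP; left; apply/eqP; ring.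
Unshelve. all: by end_near.
Qed.

Lemma jacobi_prod_lower q w : q != 0 -> cabs q < 1 -> w != 0 ->
  (forall j, w * q ^+ j != 1) -> (forall j, w^-1 * q ^+ j.+1 != 1) ->
  exists2 b, 0 < b & forall N, b <= cabs (jacobi_prod q w N).
Proof.
move=> q0 q1 w0 H1 H2; have r01 : 0 <= cabs q < 1 by rewrite cabs_ge0.
have B1 j : cabs (w * q ^+ j) <= cabs w * cabs q ^+ j by rewrite cabsM cabsX.
have B2 j : cabs (w^-1 * q ^+ j.+1) <= cabs w^-1 * cabs q * cabs q ^+ j.
  by rewrite cabsM cabsX exprS mulrA.
have [b1 b10 L1] := prod_lower r01 B1 H1.
have [b2 b20 L2] := prod_lower r01 B2 H2.
exists (b1 * b2); first exact: mulr_gt0.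
by move=> N; rewrite cabsM ler_pM ?(ltW b10) ?(ltW b20).
Qed.

(** If z is not in the lattice, no factor of the triple product vanishes, so the
    product is bounded below, while theta(z) = 0 would make it O(|q|^N). *)
Lemma theta_eq0 eta z : cabs (e_ eta) < 1 -> theta eta z = 0 -> lattice eta z.
Proof.
move=> q1 t0; apply: contrapT => nl.
have q0 := e_neq0 eta; have w0 := e_neq0 z.
have H1 j : e_ z * e_ eta ^+ j != 1.
  apply/eqP => E; apply: nl.
  have [a Ea] : exists a : int, z + j%:R * eta = a%:~R.
    by apply: e_eq1; rewrite e_D e_Mn.
  exists a, (- j%:Z); rewrite mulrNz mulNr -Ea; ring.
have H2 j : (e_ z)^-1 * e_ eta ^+ j.+1 != 1.
  apply/eqP => E; apply: nl.
  have [a Ea] : exists a : int, - z + j.+1%:R * eta = a%:~R.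
    by apply: e_eq1; rewrite e_D e_N e_Mn.
  exists (- a), j.+1; rewrite mulrNz -Ea; ring.
have [b b0 L1] := jacobi_prod_lower q0 q1 w0 H1 H2.
have [b' [B [b'0 L2 _]]] := qpoch_bounds q1.
have [C HC] := theta_jacobi z q1.
have bb := mulr_gt0 b'0 b0.
have D0 : 0 < `|C| + 1 by rewrite ltr_wpDl.
have q01 : 0 <= cabs (e_ eta) < 1 by rewrite cabs_ge0.
have e0 : 0 < b' * b / (2 * (`|C| + 1)) by rewrite divr_gt0 // mulr_gt0.
have [N HN] := expr_small q01 e0.
have := HC N; rewrite t0 sub0r cabsN cabsM => h.
have h2 := le_trans (ler_pM (ltW b'0) (ltW b0) (L2 N) (L1 N)) h.
have := HN N (leqnn N); rewrite ler_pdivlMr ?mulr_gt0 // => h3.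
have r0 : 0 <= cabs (e_ eta) ^+ N by rewrite exprn_ge0 ?cabs_ge0.
have : C * cabs (e_ eta) ^+ N <= `|C| * cabs (e_ eta) ^+ N by rewrite ler_wpM2r ?ler_norm.
lra.
Qed.

End Zeros.

(** * Transformation laws of the functions theta_alpha *)

Section ThetaAlpha.
Variables (R : realType) (eta : Cplx R) (n : nat).
Hypothesis (q1 : cabs (e_ eta) < 1) (n1 : (1 < n)%N).
Local Notation K := (Cplx R).
Implicit Types (z w : K) (a b : int) (alpha beta : 'Z_n).

Local Notation N := (n%:R : K).

Lemma natC_neq0 : N != 0. Proof. by rewrite pnatr_eq0 -lt0n ltnW. Qed.

Lemma e_half : e_ (2^-1 : K) = -1.
Proof.
have -> : (2^-1 : K) = ofR 2^-1.
  have h2 : (2 : K) != 0 by rewrite pnatr_eq0.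
  by apply: (mulfI h2); rewrite divff // -[2]ofR_nat -ofRM divff // pnatr_eq0.
rewrite /e_ /cexp /= !mul0r mulr0 subr0 add0r expR0 !mul1r.
have -> : 2 * pi * 2^-1 = pi :> R by field.
by rewrite cospi sinpi; apply/eqP; rewrite eq_complex /= oppr0 !eqxx.
Qed.

Lemma sum_ratio : \sum_(m < n) (m%:R / N) = (N - 1) / 2 :> K.
Proof.
have H k : \sum_(m < k) m%:R = k%:R * (k%:R - 1) / 2 :> K.
  elim: k => [|k IH]; first by rewrite big_ord0 mul0r mul0r.
  by rewrite big_ord_recr /= IH -natr1; field.
rewrite -mulr_suml H; field; exact: natC_neq0.
Qed.

Lemma e_sum (I : finType) (f : I -> K) : e_ (\sum_i f i) = \prod_i e_ (f i).
Proof. by elim/big_rec2: _ => [|i x y _ <-]; rewrite ?e_0 // e_D. Qed.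

(** The product in the definition of theta_alpha, which is evaluated at
    z + alpha eta / n. *)
Definition shift_prod z : K := \prod_(m < n) theta eta (z + m%:R / N).

Lemma theta_shift_prodE a z : theta_ n eta a z =
  e_ (a%:~R * z + a%:~R / (2 * N) + a%:~R * (a%:~R - N) / (2 * N) * eta) *
  shift_prod (z + a%:~R / N * eta).
Proof.
by rewrite /theta_ /shift_prod; congr (_ * _); apply: eq_bigr => m _; rewrite addrAC.
Qed.

(** A cyclic permutation of the factors, since theta has period 1. *)
Lemma shift_prod_shift z : shift_prod (z + N^-1) = shift_prod z.
Proof.
have n0 := natC_neq0; rewrite /shift_prod.
case: n n0 => [|k] n0; first by rewrite !big_ord0.
rewrite big_ord_recr big_ord_recl /= mulrC mul0r addr0; congr (_ * _).
  rewrite -[in RHS](theta_add1 z q1); congr theta.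
  by rewrite -natr1 in n0 *; field.
apply: eq_bigr => m _; congr theta.
by rewrite /bump leq0n add1n -[m.+1%:R]natr1; field.
Qed.

Lemma e_halfn : e_ (N / 2) = (-1) ^+ n.
Proof. by rewrite e_Mn e_half. Qed.

Lemma shift_prod_eta z :
  shift_prod (z + eta) = (-1) ^+ n * e_ (- (N * z) - (N - 1) / 2) * shift_prod z.
Proof.
rewrite /shift_prod (eq_bigr (fun m : 'I_n => (- e_ (- z - m%:R / N)) *
    theta eta (z + m%:R / N))); last first.
  by move=> m _; rewrite addrAC (theta_addeta _ q1) opprD.
rewrite big_split /=; congr (_ * _).
rewrite prodrN card_ord -e_sum; congr (_ * e_ _).
by rewrite sumrB sumr_const card_ord sum_ratio mulr_natl mulNrn.
Qed.

(** Turning z into - z reverses the order of the factors, up to a translation by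
    1/n. *)
Lemma shift_prod_opp z :
  shift_prod (- z) = - e_ (- (N * z)) * shift_prod z.
Proof.
rewrite /shift_prod (eq_bigr (fun m : 'I_n => (- e_ (- z + m%:R / N)) *
    theta eta (z - m%:R / N))); last first.
  move=> m _; have -> : - z + m%:R / N = - (z - m%:R / N) by rewrite opprB addrC.
  by rewrite (theta_opp _ q1).
rewrite big_split /=; congr (_ * _).
  rewrite prodrN card_ord -e_sum big_split /= sum_ratio sumr_const card_ord.
  rewrite e_D mulrBl mul1r e_D e_halfn (e_N 2^-1) e_half invrN1.
  rewrite mulrCA [(-1) ^+ n * (_ * _)]mulrA -exprD addnn -mul2n exprM sqrrN.
  by rewrite !expr1n mul1r mulrN1 mulr_natl mulNrn.
rewrite -[RHS](shift_prod_shift) /shift_prod [RHS](reindex_inj rev_ord_inj) /=.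
apply: eq_bigr => m _; rewrite -(theta_add1 _ q1); congr theta.
rewrite natrB // -natr1; field; exact: natC_neq0.
Qed.


Lemma theta_addn a z : theta_ n eta (a + n%:Z) z = theta_ n eta a z.
Proof.
have n0 := natC_neq0; rewrite !theta_shift_prodE intrD.
set A : K := a%:~R; have -> : (n%:Z)%:~R = N by [].
rewrite (_ : z + (A + N) / N * eta = z + A / N * eta + eta); last by field.
rewrite shift_prod_eta mulrA; congr (_ * _).
rewrite mulrCA -e_D -e_halfn -e_D.
set B := A * z + _ + _.
rewrite (_ : _ + _ = B + 1) ?e_D ?e_1 ?mulr1 //.
by rewrite /B; field.
Qed.

Lemma theta_add1n a z :
  theta_ n eta a (z + N^-1) = e_ (a%:~R / N) * theta_ n eta a z.
Proof.
have n0 := natC_neq0.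
rewrite !theta_shift_prodE [z + N^-1 + _]addrAC shift_prod_shift mulrA -e_D; congr (e_ _ * _).
by field.
Qed.

Definition etafactor z : K := e_ (- z - (2 * N)^-1 - (1 - N) / (2 * N) * eta).

(** The products are the same by definition, and the exponents of the exponentials
    differ by an expression in which alpha cancels.  That the factor does not
    depend on alpha is what makes all quotients of theta_alpha's transform well. *)
Lemma theta_addetan a z :
  theta_ n eta a (z + eta / N) = etafactor z * theta_ n eta (a + 1) z.
Proof.
have n0 := natC_neq0; rewrite !theta_shift_prodE intrD.
set A : K := a%:~R; rewrite mulrA /etafactor -e_D; congr (e_ _ * shift_prod _); by field.
Qed.

Lemma theta_oppn a z :
  theta_ n eta a (- z) = - e_ (- (N * z)) * e_ (a%:~R / N) * theta_ n eta (- a) z.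
Proof.
have n0 := natC_neq0; rewrite !theta_shift_prodE mulrNz.
set A : K := a%:~R; rewrite mulrA.
rewrite (_ : - z + A / N * eta = - (z + - A / N * eta)); last by field.
rewrite shift_prod_opp mulrA; congr (_ * _).
rewrite mulrN !mulNr -!e_D; congr (- e_ _); by field.
Qed.

(** This passes from integer indices to representatives in {0, ..., n-1}. *)
Lemma periodic_Zn (T : Type) (f : int -> T) :
  (forall a, f (a + n%:Z) = f a) ->
  forall a, f a = f (nat_of_ord (a%:~R : 'Z_n))%:Z.
Proof.
move=> H.
have Hk (k : nat) a : f (a + (k * n)%N%:Z) = f a.
  elim: k a => [|k IH] a; first by rewrite mul0n addr0.
  by rewrite mulSn addnC PoszD addrA H IH.
have Hn (m : nat) : f m%:Z = f (nat_of_ord (m%:R : 'Z_n))%:Z.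
  rewrite val_Zp_nat // {1}(divn_eq m n) addnC PoszD; exact: Hk.
case=> m; first exact: Hn.
rewrite NegzE -[LHS](Hk m.+1).
have E : (- m.+1%:Z + (m.+1 * n)%N%:Z)%R = (m.+1 * n.-1)%N%:Z.
  by rewrite -{1}(prednK (ltnW n1)) mulnS PoszD addrA addNr add0r.
rewrite E Hn; congr (f (nat_of_ord _)%:Z).
rewrite -[LHS]/((m.+1 * n.-1)%N%:Z%:~R) -E intrD mulrNz.
have -> : ((m.+1 * n)%N%:Z)%:~R = 0 :> 'Z_n.
  by rewrite -[LHS]/((m.+1 * n)%:R) natrM pchar_Zp // mulr0.
by rewrite addr0.
Qed.

End ThetaAlpha.

(** * Theta functions indexed by Z/nZ and their zeros *)

Section ThetaZ.
Variables (R : realType) (eta : Cplx R) (n : nat).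
Hypothesis (eta_upper : 0 < complex.Im eta) (n1 : (1 < n)%N).
Local Notation K := (Cplx R).
Implicit Types (z w : K) (a b : int) (alpha beta x y : 'Z_n).

Local Notation N := (n%:R : K).
Local Notation th := (@thetaZ R n eta).

Lemma cabs_nome_lt1 : cabs (e_ eta) < 1.
Proof.
rewrite cabs_e_ -expR0 ltr_expR oppr_lt0.
by rewrite mulr_gt0 // mulr_gt0 // pi_gt0.
Qed.
Let q1 := cabs_nome_lt1.

(** The additive character x |-> e(x/n) of Z/nZ. *)
Definition zchar x : K := e_ ((nat_of_ord x)%:R / N).

Lemma zchar_int a : e_ (a%:~R / N) = zchar a%:~R.
Proof.
apply: (periodic_Zn n1 (f := fun a => e_ (a%:~R / N))) => {}a.
by rewrite intrD mulrDl e_D divff ?e_1 ?mulr1 // natC_neq0.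
Qed.

Lemma Zn_int x : x = (nat_of_ord x)%:Z%:~R.
Proof. by rewrite -[RHS]/((nat_of_ord x)%:R) natr_Zp. Qed.

Lemma zcharD x y : zchar (x + y) = zchar x * zchar y.
Proof. by rewrite {1}(Zn_int x) {1}(Zn_int y) -intrD -zchar_int intrD mulrDl e_D. Qed.

Lemma zchar_neq0 x : zchar x != 0. Proof. exact: e_neq0. Qed.

Lemma zchar0 : zchar 0 = 1.
Proof. by rewrite -[0]/(0%:~R) -zchar_int mul0r e_0. Qed.

Lemma zcharN x : zchar (- x) = (zchar x)^-1.
Proof.
by apply: (mulfI (zchar_neq0 x)); rewrite -zcharD subrr zchar0 divff ?zchar_neq0.
Qed.

Lemma thetaZ_int a z : theta_ n eta a z = th a%:~R z.
Proof.
apply: (periodic_Zn n1 (f := fun a => theta_ n eta a z)) => {}a.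
exact: theta_addn.
Qed.

Lemma thetaZ_add1n x z : th x (z + N^-1) = zchar x * th x z.
Proof. by rewrite {1}/thetaZ (theta_add1n q1 n1). Qed.

Lemma thetaZ_addetan x z : th x (z + eta / N) = etafactor eta n z * th (x + 1) z.
Proof.
rewrite {1}/thetaZ (theta_addetan eta n1) thetaZ_int intrD.
by rewrite -Zn_int.
Qed.

Lemma thetaZ_opp x z : th x (- z) = - e_ (- (N * z)) * zchar x * th (- x) z.
Proof.
by rewrite {1}/thetaZ (theta_oppn q1 n1) thetaZ_int mulrNz -Zn_int.
Qed.

Lemma thetaZ_addrat x z a : th x (z + a%:~R / N) = zchar (x * a%:~R) * th x z.
Proof.
have Hn (k : nat) w : th x (w + k%:R / N) = zchar (x * k%:R) * th x w.
  elim: k => [|k IH]; first by rewrite mul0r addr0 mulr0 zchar0 mul1r.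
  rewrite -!natr1 mulrDl mul1r addrA thetaZ_add1n IH mulrDr mulr1 zcharD; ring.
case: (intP a) => [|k|k]; [exact: (Hn 0%N)|exact: Hn|].
have := Hn k.+1 (z + (- k.+1%:Z)%:~R / N); rewrite !mulrNz mulrN zcharN mulNr subrK.
by move=> ->; rewrite mulKf // zchar_neq0.
Qed.

Lemma etafactor_neq0 z : etafactor eta n z != 0. Proof. exact: e_neq0. Qed.

Lemma thetaZ_addeta b z : exists2 E : K, E != 0 &
  forall x, th x (z + b%:~R * eta / N) = E * th (x + b%:~R) z.
Proof.
have Hn (k : nat) w : exists2 E : K, E != 0 &
  forall x, th x (w + k%:R * eta / N) = E * th (x + k%:R) w.
  elim: k w => [|k IH] w.
    exists 1; first exact: oner_neq0.
    by move=> x; rewrite !mul0r !addr0 mul1r.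
  have [E E0 HE] := IH w; exists (etafactor eta n (w + k%:R * eta / N) * E).
    by rewrite mulf_neq0 ?etafactor_neq0.
  move=> x; have -> : x + k.+1%:R = x + 1 + k%:R by rewrite -natr1 -addrA [1 + _]addrC.
  by rewrite -natr1 2!mulrDl mul1r addrA thetaZ_addetan HE mulrA.
case: (intP b) => [|k|k]; [exact: (Hn 0%N)|exact: Hn|].
have [E E0 HE] := Hn k.+1 (z + (- k.+1%:Z)%:~R * eta / N).
exists E^-1; first by rewrite invr_eq0.
move=> x; have := HE (x + (- k.+1%:Z)%:~R).
rewrite !mulrNz !mulNr !subrK => ->; rewrite mulKf //.
Qed.

(** Translation by a torsion point permutes the theta_x, up to a character of x
    and a factor E common to all x. *)
Lemma thetaZ_shift a b z : exists2 E : K, E != 0 &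
  forall x, th x (z + (a%:~R + b%:~R * eta) / N) =
    E * zchar (x * a%:~R) * th (x + b%:~R) z.
Proof.
have [E E0 HE] := thetaZ_addeta b z; exists E => // x.
by rewrite mulrDl [_ / N + _]addrC addrA thetaZ_addrat HE; ring.
Qed.

Lemma torsionP z : torsion n eta z <->
  exists a b, z = (a%:~R + b%:~R * eta) / N.
Proof.
split=> [[w [a [b ->]] <-]|[a [b ->]]]; first by exists a, b.
by exists (a%:~R + b%:~R * eta) => //; exists a, b.
Qed.

(** One of the factors of theta_x vanishes, and the zeros of theta are in the
    lattice. *)
Lemma thetaZ_eq0 x z : th x z = 0 -> exists (m : 'I_n) a b,
  z + m%:R / N + (nat_of_ord x)%:R / N * eta = a%:~R + b%:~R * eta.
Proof.
move=> /eqP; rewrite /thetaZ /theta_ mulf_eq0 (negbTE (e_neq0 _)) /=.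
move=> /prodf_eq0[m _ /eqP /(theta_eq0 q1)[a [b H]]].
by exists m, a, b.
Qed.

Lemma thetaZ_neq0 x z : ~ torsion n eta z -> th x z != 0.
Proof.
move=> nt; apply/eqP => /thetaZ_eq0[m [a [b H]]]; apply: nt; apply/torsionP.
exists (a * n%:Z - m%:Z), (b * n%:Z - (nat_of_ord x)%:Z).
have n0 := natC_neq0 R n1.
have -> : z = a%:~R + b%:~R * eta - m%:R / N - (nat_of_ord x)%:R / N * eta.
  by rewrite -H; ring.
by rewrite !intrB !intrM; field.
Qed.

Lemma thetaZ00 : th 0 0 = 0.
Proof.
rewrite /thetaZ /theta_; case: n n1 => // k _; rewrite big_ord_recl /= !mul0r !addr0.
by rewrite (theta0 q1) mul0r mulr0.
Qed.

Lemma ofR_int b : b%:~R = ofR b%:~R :> K.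
Proof. by case: (intP b) => [|m|m]; rewrite ?mulrNz ?ofRN ?ofR_nat. Qed.

Lemma Im_mulint b : complex.Im (b%:~R * eta) = b%:~R * complex.Im eta.
Proof. by rewrite ofR_int; case: eta => u v /=; rewrite mul0r addr0. Qed.

(** A zero would give x/n integral by comparison of imaginary parts, whereas
    0 < x < n. *)
Lemma thetaZ_at0_neq0 x : x != 0 -> th x 0 != 0.
Proof.
move=> x0; apply/eqP => /thetaZ_eq0[m [a [b]]]; have n0 := natC_neq0 R n1.
set v := nat_of_ord x; rewrite add0r => H.
have {}H : (v%:Z - b * n%:Z)%:~R * eta = (a * n%:Z - m%:Z)%:~R.
  rewrite !intrB !intrM.
  transitivity (N * (m%:R / N + v%:R / N * eta - b%:~R * eta) - m%:R).
    by field.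
  by rewrite H; ring.
have := congr1 (@complex.Im R) H; rewrite Im_mulint.
rewrite (ofR_int (_ - m%:Z)) [RHS]/=.
move=> /eqP; rewrite mulf_eq0 (gt_eqF eta_upper) orbF intr_eq0 subr_eq0 => /eqP vb.
have vn : (v < n)%N by rewrite -[X in (_ < X)%N](Zp_cast n1) ltn_ord.
have v0 : v != 0%N by rewrite -(inj_eq val_inj) in x0.
move: vb; case: b H => [|] b H; last by lia.
move=> vb; have E : v = (b * n)%N by apply/eqP; rewrite -eqz_nat PoszM vb.
by move: vn; rewrite E; case: b {H vb} E => [|b] E; [lia|rewrite mulSn; lia].
Qed.

Lemma holo_thetaZ x : holo (th x).
Proof.
have ht := holo_theta q1.
apply: holoM.
  apply: (@holo_comp R (@e_ R)); first exact: holo_e.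
  apply: holoD; last exact: holo_cst.
  apply: holoD; last exact: holo_cst.
  by apply: holoM; [exact: holo_cst|exact: holo_id].
have hm (m : 'I_n) : holo (fun z : K =>
    theta eta (z + m%:R / N + (nat_of_ord x)%:Z%:~R / N * eta)).
  apply: (@holo_comp R (theta eta)
    (fun z : K => z + m%:R / N + (nat_of_ord x)%:Z%:~R / N * eta) ht).
  exact: (holoD (holoD (@holo_id R) (@holo_cst R (m%:R / N)))
            (@holo_cst R ((nat_of_ord x)%:Z%:~R / N * eta))).
exact: (holo_prod hm).
Qed.

End ThetaZ.

(** * Identity principles off the torsion points *)

Section Matrices.
Variables (R : realType) (p q : nat).
Local Notation K := (Cplx R).
Local Notation M := 'M[K]_(p.+1, q.+1).
Implicit Types (f g : K -> K) (F G : K -> M).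

Lemma derivable_cont f (z : K) : derivable f z 1 -> {for z, continuous f}.
Proof. by move=> /derivable1_diffP/differentiable_continuous. Qed.

Lemma derivable_entry F (z : K) i j :
  derivable F z 1 -> {for z, continuous (fun t => F t i j)}.
Proof.
move=> /derivable1_diffP/differentiable_continuous H.
exact: (continuous_comp H (@coord_continuous K _ _ i j _)).
Qed.

Lemma derivable_scalel f (w : M) (z : K) :
  derivable f z 1 -> derivable (fun t => f t *: w) z 1.
Proof.
move=> H.
have E : (fun h : K => h^-1 *: (((fun t => f t *: w) \o shift z) (h *: 1) - f z *: w)) =
    (fun h => (h^-1 *: ((f \o shift z) (h *: 1) - f z)) *: w).
  by apply/funext => h /=; rewrite -scalerBl scalerA.
by rewrite /derivable E; exact: (is_cvgZr_tmp (a := w) H).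
Qed.

Lemma derivable_sumE (I : Type) (s : seq I) (F : I -> K -> M) (z : K) :
  (forall i, derivable (F i) z 1) -> derivable (fun t => \sum_(i <- s) F i t) z 1.
Proof.
move=> H; elim: s => [|i s IH].
  rewrite (_ : (fun _ => _) = (fun=> 0)); last by apply/funext => t; rewrite big_nil.
  exact: derivable_cst.
rewrite (_ : (fun _ => _) = (fun t => F i t + \sum_(j <- s) F j t)).
  exact: (derivableD (H i) IH).
by apply/funext => t; rewrite big_cons.
Qed.

Lemma vline_scale (c : K) (v : M) : c != 0 -> (<[c *: v]> = <[v]>)%VS.
Proof.
move=> c0; apply/eqP; rewrite eqEsubv; apply/andP; split; rewrite -memvE.
  by apply/vlineP; exists c.
by apply/vlineP; exists c^-1; rewrite scalerA mulVf // scale1r.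
Qed.

Lemma vline_minors (v w : M) : (<[v]> = <[w]>)%VS ->
  forall i j k l, v i j * w k l = v k l * w i j.
Proof.
move=> E i j k l; have /vlineP[c ->] : v \in <[w]>%VS by rewrite -E memv_line.
by rewrite !mxE; ring.
Qed.

(** Equality of lines as a closed condition: the vanishing of all 2 x 2 minors of
    the pair of coordinate vectors. *)
Lemma minors_vline (v w : M) : v != 0 -> w != 0 ->
  (forall i j k l, v i j * w k l = v k l * w i j) -> (<[v]> = <[w]>)%VS.
Proof.
move=> v0 w0 H.
have [k [l wkl]] : exists k l, w k l != 0 by apply/matrix0Pn.
have vE : v = (v k l / w k l) *: w.
  apply/matrixP => i j; rewrite mxE; apply: (mulIf wkl); rewrite H; field.
  exact: wkl.
rewrite vE vline_scale //; apply: contraNneq v0 => E.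
by rewrite vE E scale0r.
Qed.

End Matrices.

Section TorsionDense.
Variables (R : realType) (eta : Cplx R) (n : nat).
Hypothesis (eta_upper : 0 < complex.Im eta) (n1 : (1 < n)%N).
Local Notation K := (Cplx R).
Local Notation V := 'M[K]_((Zp_trunc n).+2).
Local Notation tors := (torsion n eta).

Lemma torsionB (x y : K) : tors x -> tors y -> tors (x - y).
Proof.
move=> /(torsionP eta n)[a [b ->]] /(torsionP eta n)[a' [b' ->]].
apply/(torsionP eta n); exists (a - a'), (b - b').
by rewrite !intrB; field; exact: natC_neq0.
Qed.

Lemma small_real_not_torsion (e : R) : 0 < e -> e < n%:R^-1 -> ~ tors (ofR e).
Proof.
move=> e0 en /(torsionP eta n)[a [b H]].
have n0 : (n%:R : R) != 0 by rewrite pnatr_eq0 -lt0n ltnW.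
have {}H : ofR (n%:R * e) = a%:~R + b%:~R * eta.
  rewrite ofRM H ofR_nat; field; exact: natC_neq0.
have b0 : b = 0.
  have := congr1 (@complex.Im R) H; rewrite /= .
  have -> : complex.Im (a%:~R + b%:~R * eta) =
     complex.Im (a%:~R : K) + complex.Im (b%:~R * eta).
    by case: (a%:~R : K) (b%:~R * eta) => ? ? [].
  rewrite Im_mulint [a%:~R]ofR_int /= add0r => /esym/eqP.
  by rewrite mulf_eq0 (gt_eqF eta_upper) orbF intr_eq0 => /eqP.
move: H; rewrite b0 mul0r addr0 ofR_int => /ofR_inj H.
have h1 : 0 < n%:R * e by rewrite mulr_gt0 // ltr0n ltnW.
have h2 : n%:R * e < 1.
  by rewrite mulrC -ltr_pdivlMr ?ltr0n ?(ltnW n1) // mul1r.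
by move: h1 h2; rewrite H ltr0z -[1]/(1%:~R) ltr_int; lia.
Qed.

(** A torsion point is left by any sufficiently small real translation, because
    the difference of two torsion points is real only if it lies in (1/n)Z. *)
Lemma torsion_dense (z : K) (P : set K) :
  (\forall x \near z, P x) -> exists2 x, P x & ~ tors x.
Proof.
move=> HP; have [tz|ntz] := pselect (tors z); last first.
  by exists z => //; apply: nbhs_singleton HP.
move: HP => /nbhs_ballP[d /= d0 Hd].
have dE : d = ofR (complex.Re d).
  by apply/eqP; rewrite eq_complex /= (ger0_Im (ltW d0)) !eqxx.
have rd0 : 0 < complex.Re d by rewrite -ofR_lt -dE.
have n0 : 0 < (n%:R^-1 : R) by rewrite invr_gt0 ltr0n ltnW.
(* Smaller than 1/n, so that z + e is not a torsion point. *)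
pose e := Num.min (complex.Re d) (n%:R^-1) / 2.
have m0 : 0 < Num.min (complex.Re d) (n%:R^-1) by rewrite lt_min rd0 n0.
have e0 : 0 < e by rewrite divr_gt0.
have em : e < Num.min (complex.Re d) (n%:R^-1) by rewrite /e; lra.
move: em; rewrite lt_min => /andP[ed en].
exists (z + ofR e); last first.
  move=> /torsionB/(_ tz); rewrite addrAC subrr add0r.
  exact: small_real_not_torsion.
apply: Hd; rewrite -ball_normE /= opprD addrA subrr add0r normrN norm_cabs cabs_ofR.
by rewrite ger0_norm ?ltW // dE ofR_lt.
Qed.

Lemma eq_off_torsion (f g : K -> K) (z : K) :
  {for z, continuous f} -> {for z, continuous g} ->
  (\forall x \near z, ~ tors x -> f x = g x) -> f z = g z.
Proof.
move=> cf cg H; apply/eqP/contraT => fg.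
have e0 : 0 < cabs (f z - g z) / 2 by rewrite divr_gt0 // cabs_gt0 subr_eq0.
have {}cf : \forall x \near z, cabs (f z - f x) < cabs (f z - g z) / 2.
  by move/cvg_cabsP : cf; apply.
have {}cg : \forall x \near z, cabs (g z - g x) < cabs (f z - g z) / 2.
  by move/cvg_cabsP : cg; apply.
have [x [[hf hg] hx] nt] := torsion_dense (filterI (filterI cf cg) H).
have := cabsD (f z - f x) (- (g z - g x)).
rewrite cabsN (hx nt) (_ : _ - _ - _ = f z - g z); last by ring.
move: hf hg; rewrite (hx nt); lra.
Qed.

(** Two moving lines that agree off the torsion points agree everywhere: the
    minors are continuous.  This gives both the uniqueness of L_ij and its
    periodicity. *)
Lemma lines_agree (F G : K -> V) (z : K) :
  (forall i j, {for z, continuous (fun t => F t i j)}) ->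
  (forall i j, {for z, continuous (fun t => G t i j)}) ->
  F z != 0 -> G z != 0 ->
  (\forall x \near z, ~ tors x -> (<[F x]> = <[G x]>)%VS) ->
  (<[F z]> = <[G z]>)%VS.
Proof.
move=> cF cG F0 G0 H; apply: minors_vline => // i j k l.
apply: (@eq_off_torsion (fun t => F t i j * G t k l) (fun t => F t k l * G t i j)).
- exact: (cvgM (cF i j) (cG k l)).
- exact: (cvgM (cF k l) (cG i j)).
by apply: filterS H => x H nt; apply: vline_minors; apply: H.
Qed.

Lemma entire_ext_unique (F G : K -> 'End(V)) :
  entire_End G -> (forall z, ~ tors z -> G z = F z) -> entire_ext tors F = G.
Proof.
move=> eG GF.
have [] := @xgetPex _ (fun=> 0) [set G | entire_End G /\ forall z, ~ tors z -> G z = F z].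
  by exists G.
rewrite -/(entire_ext tors F); set G' := entire_ext _ _ => eG' GF'.
apply/funext => z; apply/lfunP => w; apply/matrixP => i j.
apply: (@eq_off_torsion (fun t => G' t w i j) (fun t => G t w i j)).
- exact: derivable_entry (eG' w z).
- exact: derivable_entry (eG w z).
by apply: (@filterE _ (nbhs z)) => x nt; rewrite GF' // GF.
Qed.

End TorsionDense.

(** * Clearing the denominators of r_ij *)

Section Relations.
Variables (R : realType) (eta : Cplx R) (n k : nat).
Hypothesis (eta_upper : 0 < complex.Im eta) (n1 : (1 < n)%N).
Hypothesis (nk : coprime n k).
Local Notation K := (Cplx R).
Local Notation Z := 'Z_n.
Local Notation V := 'M[K]_((Zp_trunc n).+2).
Local Notation N := (n%:R : K).
Local Notation th := (@thetaZ R n eta).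
Local Notation tors := (torsion n eta).
Local Notation kz := (k%:R : 'Z_n).
Local Notation zchar := (@zchar R n).
Implicit Types (i j r x y a : 'Z_n) (t z : K) (P : pred 'Z_n).

(** Non-vanishing of the numerator theta_{d+(k-1)r}(0) of the r-th coefficient. *)
Definition active i j r : bool := j - i + (kz - 1) * r != 0.

(** The unit theta_{-x}(-t) / theta_x(t). *)
Definition opp_factor x t : K := - e_ (- (N * t)) * zchar (- x).

(** The r-th coefficient of r_ij(t) multiplied by the product of the theta_a(-t)
    over the a in P, after cancellation of its denominator.  The indices d - r and
    - kr are distinct for an active r, and they are assumed to belong to P. *)
Definition ccoef P i j r t : K :=
  if active i j r then
    th (j - i + (kz - 1) * r) 0 * opp_factor (kz * r) t *
    \prod_(a | [&& P a, a != j - i - r & a != - (kz * r)]) th a (- t)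
  else 0.

Definition cleared P i j t : V := \sum_r ccoef P i j r t *: xx R (j - r) (i + r).

(** The complement is the set of the exceptional a: those for which theta_a(-t)
    divides every non-zero cleared coefficient. *)
Definition ordinary i j : pred 'Z_n := fun a => (kz - 1) * a != kz * (j - i).

Lemma kz_unit : kz \is a GRing.unit. Proof. by rewrite unitZpE. Qed.

Lemma thetaZ_opp_factor x t : th (- x) (- t) = opp_factor x t * th x t.
Proof. by rewrite (thetaZ_opp eta_upper n1) opprK. Qed.

Lemma opp_factor_neq0 x t : opp_factor x t != 0.
Proof. by rewrite mulf_neq0 ?oppr_eq0 ?e_neq0. Qed.

Lemma active_neq i j r : active i j r -> j - i - r != - (kz * r).
Proof.
apply: contraNneq => E; apply/eqP.
transitivity (j - i - r + kz * r); first by ring.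
by rewrite E addNr.
Qed.

(** With the next lemma: the two indices cancelled from an active coefficient are
    never exceptional, so that clearing with the ordinary indices suffices. *)
Lemma active_ordinary1 i j r : active i j r -> ordinary i j (j - i - r).
Proof.
apply: contraNneq => E; apply/eqP.
transitivity (kz * (j - i) - (kz - 1) * (j - i - r)); first by ring.
by rewrite E subrr.
Qed.

Lemma active_ordinary2 i j r : active i j r -> ordinary i j (- (kz * r)).
Proof.
apply: contraNneq => E; apply/eqP; apply: (mulrI kz_unit); rewrite mulr0.
transitivity (kz * (j - i) - (kz - 1) * (- (kz * r))); first by ring.
by rewrite E subrr.
Qed.

Lemma ccoef_split i j r t : ccoef xpredT i j r t =
  \prod_(a | ~~ ordinary i j a) th a (- t) * ccoef (ordinary i j) i j r t.
Proof.
rewrite /ccoef; case: ifP => [g|_]; last by rewrite mulr0.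
rewrite [RHS]mulrCA; congr (_ * _).
rewrite [LHS](bigID (ordinary i j)) /= [LHS]mulrC; congr (_ * _); apply: eq_bigl => a.
  case E : (ordinary i j a); rewrite ?andbF ?andbT //=.
  by apply/andP; split; apply: contraFneq E => ->;
    [exact: active_ordinary1 | exact: active_ordinary2].
by rewrite andbC.
Qed.

Lemma cleared_split i j t : cleared xpredT i j t =
  (\prod_(a | ~~ ordinary i j a) th a (- t)) *: cleared (ordinary i j) i j t.
Proof.
rewrite /cleared scaler_sumr; apply: eq_bigr => r _.
by rewrite ccoef_split scalerA.
Qed.

Lemma prod_without2 P (f : 'Z_n -> K) x y : P x -> P y -> x != y ->
  \prod_(a | P a) f a = f x * f y * \prod_(a | [&& P a, a != x & a != y]) f a.
Proof.
move=> Px Py xy; rewrite (bigD1 x) //= (bigD1 y) /=; last by rewrite Py eq_sym.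
by rewrite mulrA; congr (_ * _); apply: eq_bigl => a; rewrite andbA.
Qed.

Lemma torsionN t : tors t -> tors (- t).
Proof.
move=> tt; have t0 : tors 0.
  by apply/(torsionP eta n); exists 0, 0; rewrite mul0r addr0 mul0r.
by rewrite -[- t]sub0r; apply: torsionB.
Qed.

(** Off the torsion points nothing vanishes and clearing is a mere rescaling. *)
Lemma cleared_off i j t : ~ tors t -> cleared (ordinary i j) i j t =
  (\prod_(a | ordinary i j a) th a (- t)) *: r_ k eta i j t.
Proof.
move=> nt.
have ntN : ~ tors (- t) by move=> /torsionN; rewrite opprK.
rewrite /cleared /r_ scaler_sumr; apply: eq_bigr => r _; rewrite scalerA; congr (_ *: _).
rewrite /ccoef; case: ifPn => [g|]; last first.
  by rewrite negbK => /eqP ->; rewrite (thetaZ00 eta_upper n1) mul0r mulr0.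
have P1 := active_ordinary1 g; have P2 := active_ordinary2 g.
rewrite (prod_without2 (fun a => th a (- t)) P1 P2 (active_neq g)) thetaZ_opp_factor.
have a0 := thetaZ_neq0 eta_upper n1 (j - i - r) ntN.
have b0 := thetaZ_neq0 eta_upper n1 (kz * r) nt.
by field; rewrite a0 b0.
Qed.

Lemma xxE i j : xx R i j = delta_mx i j.
Proof. by rewrite /xx /tens /xbase trmx_delta mul_delta_mx. Qed.

(** Distinct r give distinct basis vectors, so that a single non-zero coefficient
    makes the vector non-zero. *)
Lemma cleared_entry P i j t s : cleared P i j t (j - s) (i + s) = ccoef P i j s t.
Proof.
rewrite /cleared summxE (bigD1 s) //= xxE !mxE !eqxx mulr1 big1 ?addr0 // => r rs.
by rewrite xxE !mxE [i + s == _](inj_eq (addrI i)) [s == r]eq_sym (negbTE rs) andbF mulr0.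
Qed.

Lemma holo_ccoef P i j r : holo (ccoef P i j r).
Proof.
have [g|g] := boolP (active i j r); last first.
  rewrite (_ : ccoef P i j r = fun=> 0); first exact: holo_cst.
  by apply/funext => t; rewrite /ccoef (negbTE g).
rewrite (_ : ccoef P i j r = fun t => th (j - i + (kz - 1) * r) 0 *
    opp_factor (kz * r) t *
    \prod_(a | [&& P a, a != j - i - r & a != - (kz * r)]) th a (- t)); last first.
  by apply/funext => t; rewrite /ccoef g.
have hN : holo (fun t : K => - t) := holoN (@holo_id R).
have hp a : holo (fun t => th a (- t)).
  by apply: (@holo_comp R (th a) (fun t => - t) _ hN); apply: holo_thetaZ.
have hu : holo (opp_factor (kz * r)).
  have h1 : holo (fun t : K => - (N * t)).
    exact: (holoN (holoM (@holo_cst R N) (@holo_id R))).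
  have h2 := @holo_comp R (@e_ R) (fun t => - (N * t)) (@holo_e R) h1.
  exact: (holoM (holoN h2) (@holo_cst R (zchar (- (kz * r))))).
apply: holoM; last exact: (holo_prod hp).
exact: (holoM (@holo_cst R (th (j - i + (kz - 1) * r) 0)) hu).
Qed.

Lemma derivable_cleared P i j t : derivable (cleared P i j) t 1.
Proof.
apply: derivable_sumE => r; apply: derivable_scalel; exact: holo_ccoef.
Qed.

(** Values at a torsion point of all the theta_x, in terms of their values at 0. *)
Lemma thetaZ_class (a b : int) t : t = (a%:~R + b%:~R * eta) / N ->
  exists2 E : K, E != 0 & forall x,
    th x t = E * zchar (x * a%:~R) * th (x + b%:~R) 0.
Proof.
move=> ->; have [E E0 HE] := thetaZ_shift eta_upper n1 a b 0.
by exists E => // x; rewrite -HE add0r.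
Qed.

Lemma thetaZ_class_opp (a b : int) t E x :
  (forall x, th x t = E * zchar (x * a%:~R) * th (x + b%:~R) 0) ->
  th x (- t) = - e_ (- (N * t)) * zchar x *
    (E * zchar (- (x * a%:~R)) * th (b%:~R - x) 0).
Proof.
by move=> H; rewrite (thetaZ_opp eta_upper n1) H (mulNr x) [- x + _]addrC.
Qed.

Lemma thetaZ_torsion t : tors t ->
  exists b : 'Z_n, forall x, (th x (- t) == 0) = (x == b).
Proof.
move=> /(torsionP eta n)[a [b tE]]; have [E E0 HE] := thetaZ_class tE.
exists b%:~R => x; rewrite (thetaZ_class_opp _ HE).
have h1 : - e_ (- (N * t)) * zchar x != 0.
  by apply: mulf_neq0; [rewrite oppr_eq0 e_neq0 | exact: zchar_neq0].
have h2 : E * zchar (- (x * a%:~R)) != 0 by apply: mulf_neq0 E0 (zchar_neq0 _ _).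
rewrite mulf_eq0 (negbTE h1) mulf_eq0 (negbTE h2) 2!orFb.
apply/eqP/eqP => [H|->]; last by rewrite subrr (thetaZ00 eta_upper n1).
apply/esym/eqP; rewrite -subr_eq0; apply/eqP; apply: contrapT => /eqP bx.
by have := thetaZ_at0_neq0 eta_upper n1 bx; rewrite H eqxx.
Qed.

(** At a point of ordinary class b the coefficient r = d - b contains no factor
    theta_b(-t), and at a point of exceptional class no coefficient does. *)
Lemma cleared_neq0 i j t : (exists r, active i j r) -> cleared (ordinary i j) i j t != 0.
Proof.
have ccoef_neq0 r : active i j r ->
    (forall x, ordinary i j x -> x != j - i - r -> x != - (kz * r) ->
       th x (- t) != 0) -> ccoef (ordinary i j) i j r t != 0.
  move=> g H; rewrite /ccoef g mulf_neq0 //.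
    by rewrite mulf_neq0 ?opp_factor_neq0 // (thetaZ_at0_neq0 eta_upper n1).
  by apply/prodf_neq0 => x /and3P[*]; apply: H.
move=> [r g]; suff [s Hs] : exists s, ccoef (ordinary i j) i j s t != 0.
  by apply: contraNneq Hs => E; rewrite -(cleared_entry (ordinary i j)) E mxE.
have [/thetaZ_torsion[b Hb]|nt] := pselect (tors (t)); last first.
  exists r; apply: ccoef_neq0 => // x _ _ _; apply: (thetaZ_neq0 eta_upper n1) => tN.
  by apply: nt; rewrite -[t]opprK; apply: torsionN.
have [bn|be] := boolP (ordinary i j b).
  (* The factor theta_b(-t) is the one cancelled from the term r = d - b. *)
  exists (j - i - b); apply: ccoef_neq0.
    apply: contraNneq bn => E; apply/eqP/esym/eqP; rewrite -subr_eq0 -E.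
    by apply/eqP; ring.
  by move=> x _ xb _; rewrite Hb; apply: contraNneq xb => ->; apply/eqP; ring.
exists r; apply: ccoef_neq0 => // x xn _ _.
by rewrite Hb; apply: contraNneq be => <-.
Qed.

End Relations.

(** * The lines L_ij and the operators R_tau(tau) *)

Section Extensions.
Variables (R : realType) (eta : Cplx R) (n k : nat).
Hypothesis (eta_upper : 0 < complex.Im eta) (n1 : (1 < n)%N).
Hypothesis (nk : coprime n k).
Local Notation K := (Cplx R).
Local Notation Z := 'Z_n.
Local Notation V := 'M[K]_((Zp_trunc n).+2).
Local Notation N := (n%:R : K).
Local Notation th := (@thetaZ R n eta).
Local Notation tors := (torsion n eta).
Local Notation kz := (k%:R : 'Z_n).
Local Notation zchar := (@zchar R n).
Implicit Types (i j r x y a : 'Z_n) (t z : K) (P : pred 'Z_n).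

Lemma prod_th_neq0 P t : ~ tors t -> \prod_(a | P a) th a (- t) != 0.
Proof.
move=> nt; apply/prodf_neq0 => a _; apply: (thetaZ_neq0 eta_upper n1).
by move=> /(torsionN n1); rewrite opprK.
Qed.

Lemma cleared_line i j t : ~ tors t ->
  (<[cleared eta k (ordinary k i j) i j t]> = <[r_ k eta i j t]>)%VS.
Proof.
move=> nt; rewrite (cleared_off eta_upper n1 nk i j nt).
by rewrite vline_scale // prod_th_neq0.
Qed.

Lemma r_nonzeroP i j : r_nonzero k eta i j <-> exists r, active k i j r.
Proof.
split=> [[t [nt rt]]|gr].
  apply: contrapT => ng; apply: rt; apply/matrixP => a b.
  rewrite /r_ summxE mxE big1 // => r _.
  have E : j - i + (kz - 1) * r = 0.
    by apply/eqP/negbNE/negP => g; apply: ng; exists r.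
  by rewrite E (thetaZ00 eta_upper n1) mul0r scale0r mxE.
have [t _ nt] := torsion_dense eta_upper n1 (@filterT _ (nbhs (0 : K)) _).
exists t; split=> // rt.
have := cleared_neq0 eta_upper n1 t gr.
by rewrite (cleared_off eta_upper n1 nk i j nt) rt scaler0 eqxx.
Qed.

Lemma latticeM_torsion lam : lattice eta lam -> tors lam.
Proof.
move=> [a [b ->]]; apply/(torsionP eta n).
exists (a * n%:Z), (b * n%:Z); rewrite !intrM; field; exact: natC_neq0.
Qed.

Lemma thetaZ_lattice lam z : lattice eta lam -> exists2 E : K, E != 0 &
  forall x, th x (z + lam) = E * th x z.
Proof.
move=> [a [b ->]].
have [E E0 HE] := thetaZ_shift eta_upper n1 (a * n%:Z) (b * n%:Z) z.
exists E => // x; have := HE x.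
have -> : (a * n%:Z)%:~R = 0 :> 'Z_n.
  by rewrite intrM -[n%:Z%:~R]/(n%:R) pchar_Zp // mulr0.
have -> : (b * n%:Z)%:~R = 0 :> 'Z_n.
  by rewrite intrM -[n%:Z%:~R]/(n%:R) pchar_Zp // mulr0.
rewrite mulr0 addr0 (zchar0 R n1) mulr1 => <-; congr th.
by rewrite !intrM; field; exact: natC_neq0.
Qed.

Lemma r_lattice lam i j t : lattice eta lam ->
  exists2 c : K, c != 0 & r_ k eta i j (t + lam) = c *: r_ k eta i j t.
Proof.
move=> Hl.
have Hl' : lattice eta (- lam).
  by case: Hl => a [b ->]; exists (- a), (- b); rewrite !mulrNz; ring.
have [E E0 HE] := thetaZ_lattice t Hl; have [E' E'0 HE'] := thetaZ_lattice (- t) Hl'.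
exists (E' * E)^-1; first by rewrite invr_eq0 mulf_neq0.
rewrite /r_ scaler_sumr; apply: eq_bigr => r _; rewrite scalerA; congr (_ *: _).
by rewrite opprD HE HE' mulrACA invfM mulrCA.
Qed.

Lemma cleared_continuous P i j z a b : {for z, continuous (fun t => cleared eta k P i j t a b)}.
Proof. by apply: (derivable_entry (F := cleared eta k P i j)); apply: derivable_cleared. Qed.

Lemma cleared_morphism i j : (exists r, active k i j r) ->
  morphism_E eta (fun t => <[cleared eta k (ordinary k i j) i j t]>%VS).
Proof.
move=> gr; split.
  move=> z; exists (cleared eta k (ordinary k i j) i j); apply: (@filterE _ (nbhs z)) => t.
  by split=> //; [exact: derivable_cleared | exact: cleared_neq0].
move=> z lam Hl.
apply: (@lines_agree R eta n eta_upper n1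
   (fun t => cleared eta k (ordinary k i j) i j (t + lam)) (cleared eta k (ordinary k i j) i j) z).
- move=> a b; have cs : {for z, continuous (fun t : K => t + lam)}.
    by apply: derivable_cont; apply: (holoD (@holo_id R) (@holo_cst R lam)).
  exact: (continuous_comp cs (@cleared_continuous _ _ _ (z + lam) a b)).
- by move=> a b; exact: cleared_continuous.
- exact: cleared_neq0.
- exact: cleared_neq0.
apply: (@filterE _ (nbhs z)) => t nt.
have nt' : ~ tors (t + lam).
  move=> H; apply: nt; rewrite -[t](addrK lam); apply: torsionB => //.
  exact: latticeM_torsion.
rewrite !cleared_line //; have [c c0 ->] := r_lattice i j t Hl.
exact: vline_scale.
Qed.

(** The lines spanned by the cleared vectors form a morphism that extends
    C r_ij, and such an extension is unique. *)
Lemma L_E i j : (exists r, active k i j r) ->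
  L_ k eta i j = fun t => <[cleared eta k (ordinary k i j) i j t]>%VS.
Proof.
move=> gr.
have [] := @xgetPex _ (fun=> 0%VS) [set L | morphism_E eta L /\
      forall tau, ~ torsion n eta tau -> L tau = <[r_ k eta i j tau]>%VS].
  exists (fun t => <[cleared eta k (ordinary k i j) i j t]>%VS); split.
    exact: cleared_morphism.
  by move=> t nt; apply: cleared_line.
rewrite -/(L_ k eta i j); set L := L_ _ _ _ _ => -[hL _] HL.
apply/funext => z; have [v Hv] := hL z.
have [dv v0 Lv] := nbhs_singleton Hv; rewrite Lv.
apply: (@lines_agree R eta n eta_upper n1) => //.
- by move=> a b; apply: derivable_entry dv.
- by move=> a b; exact: cleared_continuous.
- exact: cleared_neq0.
apply: filterS Hv => t [_ _ Lt] nt.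
by rewrite -Lt HL // cleared_line.
Qed.

Definition theta_const : K := \prod_(a : 'Z_n | a != 0) th a 0.

Lemma theta_const_neq0 : theta_const != 0.
Proof. by apply/prodf_neq0 => a a0; apply: thetaZ_at0_neq0. Qed.

Lemma opxx_apply (v : 'Z_n -> 'Z_n -> V) (w : V) :
  opxx v w = \sum_(i : 'Z_n) \sum_(j : 'Z_n) w i j *: v i j.
Proof.
rewrite {1}[w]matrix_sum_delta linear_sum; apply: eq_bigr => i _.
rewrite linear_sum; apply: eq_bigr => j _.
by rewrite linearZ /= -xxE opxxE.
Qed.

Lemma opxx_entire (v : K -> 'Z_n -> 'Z_n -> V) :
  (forall i j t, derivable (fun t => v t i j) t 1) ->
  entire_End (fun t => opxx (v t)).
Proof.
move=> H w z.
rewrite (_ : (fun t => _) = (fun t => \sum_(i : 'Z_n) \sum_(j : 'Z_n) w i j *: v t i j)).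
  apply: derivable_sumE => i; apply: derivable_sumE => j.
  exact: (derivableZ (H i j z)).
by apply/funext => t; rewrite opxx_apply.
Qed.

(** The removable singularities in z are removed by cancelling theta_{d-r}(-z)
    against the product of all the theta_a(-z). *)
Definition R_cleared i j t z : V := theta_const^-1 *: \sum_r
  ((th (j - i + r * (kz - 1)) (- z + t) / th (kz * r) t) *
    \prod_(a | a != j - i - r) th a (- z)) *: xx R (j - r) (i + r).

Lemma R_E t : ~ tors t -> R_ n k eta t = fun z => opxx (fun i j => R_cleared i j t z).
Proof.
move=> nt; apply: (entire_ext_unique eta_upper n1).
  apply: opxx_entire => i j z; apply: derivableZ; apply: derivable_sumE => r.
  apply: derivable_scalel.
  have hN : holo (fun z : K => - z) := holoN (@holo_id R).
  have h1 : holo (fun z : K => - z + t) := holoD hN (@holo_cst R t).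
  have hp a : holo (fun z => th a (- z)).
    by apply: (@holo_comp R (th a) (fun z => - z) _ hN); apply: holo_thetaZ.
  have h2 : holo (fun z => th (j - i + r * (kz - 1)) (- z + t)).
    by apply: (@holo_comp R (th (j - i + r * (kz - 1))) _ _ h1); apply: holo_thetaZ.
  have h3 : holo (fun z => th (j - i + r * (kz - 1)) (- z + t) / th (kz * r) t).
    exact: (holoM h2 (@holo_cst R (th (kz * r) t)^-1)).
  have h4 : holo (fun z => \prod_(a | a != j - i - r) th a (- z)) by apply: holo_prod.
  by have H := holoM h3 h4; apply: H.
move=> z ntz; rewrite /R_formula; congr opxx; apply/funext => i; apply/funext => j.
rewrite /R_cleared -/theta_const [in RHS]mulrC -scalerA; congr (_ *: _).
rewrite scaler_sumr; apply: eq_bigr => r _; rewrite scalerA; congr (_ *: _).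
rewrite [in RHS](bigD1 (j - i - r)) //=.
have ntN : ~ tors (- z) by move=> /(torsionN n1); rewrite opprK.
have a0 := thetaZ_neq0 eta_upper n1 (j - i - r) ntN.
have b0 := thetaZ_neq0 eta_upper n1 (kz * r) nt.
move: (\prod_(a | _) _) => Q.
by field; rewrite a0 b0.
Qed.

(** At z = t the numerator of the matrix coefficient becomes theta_{d+(k-1)r}(0),
    and the remaining denominator theta_{kr}(t) cancels against theta_{-kr}(-t). *)
Lemma R_diagE : R_diag n k eta =
  fun t => opxx (fun i j => theta_const^-1 *: cleared eta k xpredT i j t).
Proof.
apply: (entire_ext_unique eta_upper n1).
  by apply: opxx_entire => i j z; apply/derivableZ/derivable_cleared.
move=> t nt; rewrite (R_E nt); congr opxx; apply/funext => i; apply/funext => j.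
rewrite /R_cleared; congr (_ *: _); apply: eq_bigr => r _; congr (_ *: _).
rewrite addNr [r * _]mulrC /ccoef; case: ifPn => [g|]; last first.
  by rewrite negbK => /eqP ->; rewrite (thetaZ00 eta_upper n1) !mul0r.
rewrite [in RHS](bigD1 (- (kz * r))) /=; last by rewrite eq_sym; apply: active_neq.
rewrite thetaZ_opp_factor //.
have b0 := thetaZ_neq0 eta_upper n1 (kz * r) nt.
by move: (\prod_(a | _) _) => Q; field.
Qed.

End Extensions.

(** * Exceptional classes *)

Section Exceptional.
Variables (R : realType) (eta : Cplx R) (n k : nat).
Hypothesis (eta_upper : 0 < complex.Im eta) (n1 : (1 < n)%N).
Hypothesis (nk : coprime n k).
Local Notation K := (Cplx R).
Local Notation Z := 'Z_n.
Local Notation V := 'M[K]_((Zp_trunc n).+2).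
Local Notation N := (n%:R : K).
Local Notation th := (@thetaZ R n eta).
Local Notation tors := (torsion n eta).
Local Notation kz := (k%:R : 'Z_n).
Local Notation zchar := (@zchar R n).
Implicit Types (i j r s x y : 'Z_n) (t z : K) (P : pred 'Z_n).

Lemma cleared_limg i j t : cleared eta k xpredT i j t \in limg (R_diag n k eta t).
Proof.
have -> : cleared eta k xpredT i j t = theta_const eta n *: R_diag n k eta t (xx R i j).
  by rewrite R_diagE // opxxE scalerA divff ?scale1r // theta_const_neq0.
by rewrite memvZ // memv_img // memvf.
Qed.

Lemma kz_eq0 s : (kz * s == 0) = (s == 0).
Proof. exact: mulrI_eq0 (mulrI (kz_unit n1 nk)). Qed.

(** The antisymmetry of theta constants, from which the sign in the pairing of
    coefficients comes. *)
Lemma thetaZ_at0_opp x : th (- x) 0 = - zchar (- x) * th x 0.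
Proof.
have := thetaZ_opp eta_upper n1 (- x) 0.
by rewrite oppr0 opprK mulr0 oppr0 e_0 mulN1r.
Qed.

(** If 2s = 0, then (k-1)s = 0: clear for odd k, and for even k because n is then
    odd and s = 0.  So the two basis vectors paired below are distinct. *)
Lemma doubled_neq0 s : (kz - 1) * s != 0 -> s + s != 0.
Proof.
apply: contraNneq => s2; have [ko|ke] := boolP (odd k).
  have -> : kz = 1 + 2 * k./2%:R.
    by rewrite -[in LHS](odd_double_half k) ko natrD -mul2n natrM.
  rewrite (_ : _ * s = k./2%:R * (s + s)); last by ring.
  by rewrite s2 mulr0.
have no : odd n.
  apply: contraT => ne; move: nk; rewrite /coprime => /eqP g1.
  have : (2 %| gcdn n k)%N by rewrite dvdn_gcd !dvdn2 ne ke.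
  by rewrite g1.
suff -> : s = 0 by rewrite mulr0.
have nE : (n./2.*2).+1 = n by rewrite -[RHS]odd_double_half no.
have E : (1 + 2 * n./2%:R) * s = 0.
  rewrite -natrM mul2n -[1]/(1%:R) -natrD add1n nE pchar_Zp // mul0r //.
rewrite (_ : s = (1 + 2 * n./2%:R) * s - n./2%:R * (s + s)); last by ring.
by rewrite E s2 mulr0 subr0.
Qed.

(** The point t is (a + b eta)/n, known only through the values of the theta_x.
    An exceptional class for (i, j) satisfies (k-1)b = k(j - i); writing b = k b'
    turns this into j = i + (k-1) b', which removes all divisions by k. *)
Variables (t : K) (a b : int) (i b' : 'Z_n) (E : K).
Hypothesis (E0 : E != 0) (bE : b%:~R = kz * b').
Hypothesis (thE : forall x, th x t = E * zchar (x * a%:~R) * th (x + b%:~R) 0).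

Let j := i + (kz - 1) * b'.
Let W : K := - e_ (- (N * t)).
Local Notation x := (kz * b').

Let W0 : W != 0. Proof. by rewrite oppr_eq0 e_neq0. Qed.

Let thEN y : th y (- t) = W * zchar y * (E * zchar (- (y * a%:~R)) * th (x - y) 0).
Proof. by rewrite (thetaZ_class_opp eta_upper n1 _ thE) bE. Qed.

Let thN_eq0 y : (th y (- t) == 0) = (y == x).
Proof.
apply/idP/idP => [|/eqP ->]; last by rewrite thEN subrr thetaZ00 // !mulr0.
apply: contraTT => yx; rewrite thEN.
apply: mulf_neq0; first by apply: mulf_neq0 W0 (zchar_neq0 _ _).
apply: mulf_neq0; first by apply: mulf_neq0 E0 (zchar_neq0 _ _).
by apply: thetaZ_at0_neq0 => //; rewrite subr_eq0 eq_sym.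
Qed.

Definition ordinary_prod : K := \prod_(y | ordinary k i j y) th y (- t).
Definition punctured_prod : K := \prod_(y | y != x) th y (- t).

Lemma ccoef_exc s : (kz - 1) * s != 0 ->
  ccoef eta k (ordinary k i j) i j (- b' + s) t =
  th ((kz - 1) * s) 0 * (W * zchar (x - kz * s)) *
  (ordinary_prod / (th (x - s) (- t) * th (x - kz * s) (- t))).
Proof.
move=> s0.
have E1 : j - i + (kz - 1) * (- b' + s) = (kz - 1) * s by rewrite /j; ring.
have E2 : j - i - (- b' + s) = x - s by rewrite /j; ring.
have E3 : - (kz * (- b' + s)) = x - kz * s by ring.
have g : active k i j (- b' + s) by rewrite /active E1.
have g1 := active_ordinary1 g; have g2 := active_ordinary2 n1 nk g; have g3 := active_neq g.
rewrite /ccoef g E1 E2 E3 /opp_factor E3 -/W; congr (_ * _).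
rewrite E2 in g1 g3; rewrite E3 in g2 g3.
rewrite /ordinary_prod (prod_without2 (fun y => th y (- t)) g1 g2 g3).
have h1 : th (x - s) (- t) != 0.
  rewrite thN_eq0 -subr_eq0 addrAC subrr add0r oppr_eq0.
  by apply: contraNneq s0 => ->; rewrite mulr0.
have h2 : th (x - kz * s) (- t) != 0.
  rewrite thN_eq0 -subr_eq0 addrAC subrr add0r oppr_eq0.
  by rewrite kz_eq0; apply: contraNneq s0 => ->; rewrite mulr0.
by rewrite [RHS]mulrAC divff ?mul1r // mulf_neq0.
Qed.

Lemma ccoef_exc0 s : (kz - 1) * s = 0 -> ccoef eta k (ordinary k i j) i j (- b' + s) t = 0.
Proof.
move=> s0; have E1 : j - i + (kz - 1) * (- b' + s) = (kz - 1) * s by rewrite /j; ring.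
by rewrite /ccoef /active E1 s0 eqxx.
Qed.

Lemma ccoef_zero i' j' r : x != j' - i' - r -> x != - (kz * r) ->
  ccoef eta k xpredT i' j' r t = 0.
Proof.
move=> h1 h2; rewrite /ccoef; case: ifP => // _.
rewrite (bigD1 x) /=; last by rewrite h1 h2.
have /eqP -> : th x (- t) == 0 by rewrite thN_eq0.
by rewrite mul0r mulr0.
Qed.

Lemma prod_without1 y (f : 'Z_n -> K) P : P y -> f y != 0 ->
  \prod_(u | P u && (u != y)) f u = (\prod_(u | P u) f u) / f y.
Proof. by move=> Py fy; rewrite [in RHS](bigD1 y) //= mulrAC divff // mul1r. Qed.

Lemma ccoef_gen1 s : s + s != 0 ->
  ccoef eta k xpredT (i - s) (j + s) (- b' + s + s) t =
  th (kz * s + kz * s) 0 * (W * zchar (x - (kz * s + kz * s))) *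
  (punctured_prod / th (x - (kz * s + kz * s)) (- t)).
Proof.
move=> s0.
have E1 : j + s - (i - s) + (kz - 1) * (- b' + s + s) = kz * s + kz * s by rewrite /j; ring.
have E2 : j + s - (i - s) - (- b' + s + s) = x by rewrite /j; ring.
have E3 : - (kz * (- b' + s + s)) = x - (kz * s + kz * s) by ring.
have zz : kz * s + kz * s != 0 by rewrite -mulrDr kz_eq0.
rewrite /ccoef /active E1 zz E2 E3 /opp_factor E3 -/W; congr (_ * _).
rewrite /punctured_prod -(prod_without1 (y := x - (kz * s + kz * s)) (f := fun y => th y (- t))
  (P := fun y => y != x)) //.
  by rewrite -subr_eq0 addrAC subrr add0r oppr_eq0.
by rewrite thN_eq0 -subr_eq0 addrAC subrr add0r oppr_eq0.
Qed.

Lemma ccoef_gen2 s : s + s != 0 ->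
  ccoef eta k xpredT (i - s) (j + s) (- b') t =
  th (s + s) 0 * (W * zchar x) * (punctured_prod / th (x + (s + s)) (- t)).
Proof.
move=> s0.
have E1 : j + s - (i - s) + (kz - 1) * (- b') = s + s by rewrite /j; ring.
have E2 : j + s - (i - s) - (- b') = x + (s + s) by rewrite /j; ring.
have E3 : - (kz * (- b')) = x by ring.
rewrite /ccoef /active E1 s0 E2 E3 /opp_factor E3 -/W; congr (_ * _).
rewrite /punctured_prod -(prod_without1 (y := x + (s + s)) (f := fun y => th y (- t))
  (P := fun y => y != x)) //.
- by apply: eq_bigl => y; rewrite /= andbC.
- by rewrite -subr_eq0 addrAC subrr add0r.
by rewrite thN_eq0 -subr_eq0 addrAC subrr add0r.
Qed.

(** Only the coefficients that lose the factor theta_b(-t) survive at a point of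
    class b, that is r with d' - r = b or - kr = b, where d' = d + 2s. *)
Lemma cleared_two_terms s : s + s != 0 ->
  cleared eta k xpredT (i - s) (j + s) t =
  ccoef eta k xpredT (i - s) (j + s) (- b' + s + s) t *: xx R (j + b' - s) (i - b' + s) +
  ccoef eta k xpredT (i - s) (j + s) (- b') t *: xx R (j + b' + s) (i - b' - s).
Proof.
move=> s0; rewrite /cleared (bigD1 (- b' + s + s)) //= (bigD1 (- b')) /=; last first.
  rewrite -subr_eq0 (_ : - b' - (- b' + s + s) = - (s + s)) ?oppr_eq0 //; ring.
have i1 : j + s - (- b' + s + s) = j + b' - s by ring.
have i2 : i - s + (- b' + s + s) = i - b' + s by ring.
have i3 : j + s - - b' = j + b' + s by ring.
have i4 : i - s - b' = i - b' - s by ring.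
rewrite i1 i2 i3 i4 big1; first by rewrite addr0.
move=> r /andP[r1 r2]; rewrite ccoef_zero ?scale0r //.
  apply: contraNneq r1 => e1; apply/eqP.
  transitivity (j + s - (i - s) - x); first by rewrite e1; ring.
  by rewrite /j; ring.
apply: contraNneq r2 => e2; apply/eqP.
have /eqP : kz * (r + b') = 0 by rewrite mulrDr e2 addrN.
by rewrite kz_eq0 addr_eq0 => /eqP.
Qed.

(** Both ratios equal - e(2(k+1)sa/n): after the theta values at t are expressed
    by theta constants, these cancel up to the signs and characters produced by
    antisymmetry. *)
Lemma ccoef_ratio s : (kz - 1) * s != 0 ->
  ccoef eta k xpredT (i - s) (j + s) (- b' + s + s) t != 0 /\
  ccoef eta k (ordinary k i j) i j (- b' + s) t * ccoef eta k xpredT (i - s) (j + s) (- b') t =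
  ccoef eta k (ordinary k i j) i j (- b' - s) t *
    ccoef eta k xpredT (i - s) (j + s) (- b' + s + s) t.
Proof.
move=> s1; have s2 := doubled_neq0 s1.
have s0 : s != 0 by apply: contraNneq s1 => ->; rewrite mulr0.
have sN : (kz - 1) * - s != 0 by rewrite mulrN oppr_eq0.
rewrite ccoef_gen1 // ccoef_gen2 // ccoef_exc // ccoef_exc //.
have zz : kz * s + kz * s != 0 by rewrite -mulrDr kz_eq0.
have Q10 : punctured_prod != 0 by apply/prodf_neq0 => y; rewrite thN_eq0.
split.
  apply: mulf_neq0.
    apply: mulf_neq0; first exact: thetaZ_at0_neq0.
    exact: mulf_neq0 W0 (zchar_neq0 _ _).
  apply: mulf_neq0 => //; rewrite invr_eq0 thN_eq0.
  by rewrite -subr_eq0 addrAC subrr add0r oppr_eq0.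
rewrite !thEN.
have S1 : x - (x - s) = s by ring. have S2 : x - (x - kz * s) = kz * s by ring.
have S3 : x - (x - (kz * s + kz * s)) = kz * s + kz * s by ring.
have S4 : x - (x + (s + s)) = - (s + s) by ring.
have S5 : x - (x - - s) = - s by ring. have S6 : x - (x - kz * - s) = - (kz * s) by ring.
have S7 : (kz - 1) * - s = - ((kz - 1) * s) by ring.
rewrite S1 S2 S3 S4 S5 S6 S7 !thetaZ_at0_opp.
have S8 : (kz - 1) * s = kz * s - s by ring.
rewrite S8.
have F1 := thetaZ_at0_neq0 eta_upper n1 s0.
have F2 : th (kz * s) 0 != 0 by apply: thetaZ_at0_neq0 => //; rewrite kz_eq0.
have F3 := thetaZ_at0_neq0 eta_upper n1 zz.
have F4 := thetaZ_at0_neq0 eta_upper n1 s2.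
move: F1 F2 F3 F4 (W0) Q10.
move: (th s 0) (th (kz * s) 0) (th (kz * s + kz * s) 0) (th (s + s) 0) (th (kz * s - s) 0).
move: (W) ordinary_prod punctured_prod => w d q f1 f2 f3 f4 f5 F1 F2 F3 F4 w0 q0.
have -> : x - - s = x + s by ring.
have -> : x - kz * - s = x + kz * s by ring.
have -> : (x - s) * a%:~R = x * a%:~R - s * a%:~R by ring.
have -> : (x + s) * a%:~R = x * a%:~R + s * a%:~R by ring.
have -> : (x - kz * s) * a%:~R = x * a%:~R - kz * s * a%:~R by ring.
have -> : (x + kz * s) * a%:~R = x * a%:~R + kz * s * a%:~R by ring.
have -> : (x + (s + s)) * a%:~R = x * a%:~R + (s * a%:~R + s * a%:~R) by ring.
have -> : (x - (kz * s + kz * s)) * a%:~R =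
  x * a%:~R - (kz * s * a%:~R + kz * s * a%:~R) by ring.
rewrite !(opprB, opprD, opprK) !(zcharD R n1) !(zcharN R n1).
have c1 := @zchar_neq0 R n x; have c2 := @zchar_neq0 R n s.
have c3 := @zchar_neq0 R n (kz * s); have c4 := @zchar_neq0 R n (x * a%:~R).
have c5 := @zchar_neq0 R n (s * a%:~R); have c6 := @zchar_neq0 R n (kz * s * a%:~R).
move: c1 c2 c3 c4 c5 c6.
move: (zchar x) (zchar s) (zchar (kz * s)) (zchar (x * a%:~R)) (zchar (s * a%:~R)).
move: (zchar (kz * s * a%:~R)) => y6 y1 y2 y3 y4 y5 c1 c2 c3 c4 c5 c6.
by field; rewrite c4 c3 F3 c6 E0 c1 w0 c2 c5 F2 F1 F4.
Qed.

End Exceptional.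

(** * The image of R_tau(tau) and the space of relations *)

Section Image.
Variables (R : realType) (eta : Cplx R) (n k : nat).
Hypothesis (eta_upper : 0 < complex.Im eta) (n1 : (1 < n)%N).
Hypothesis (nk : coprime n k).
Local Notation K := (Cplx R).
Local Notation th := (@thetaZ R n eta).
Local Notation kz := (k%:R : 'Z_n).
Implicit Types (i j r s x y : 'Z_n) (t z : K).

(** The generator of L_ij is summed twice, over s and over - s, so that the
    coefficients at s and - s are paired without choosing representatives of
    {s, -s}. *)
Lemma cleared_exceptional_limg t i b' (a b : int) (E : K) :
  E != 0 -> b%:~R = kz * b' ->
  (forall x, th x t = E * zchar R (x * a%:~R) * th (x + b%:~R) 0) ->
  cleared eta k (ordinary k i (i + (kz - 1) * b')) i (i + (kz - 1) * b') t
    \in limg (R_diag n k eta t).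
Proof.
move=> E0 bE thE; set j := i + _; set P := ordinary k i j.
pose f r := ccoef eta k P i j r t *: xx R (j - r) (i + r).
have pairP s : f (- b' + s) + f (- b' - s) \in limg (R_diag n k eta t).
  have [s0|s0] := eqVneq ((kz - 1) * s) 0.
    have c0 s' : (kz - 1) * s' = 0 -> ccoef eta k P i j (- b' + s') t = 0.
      exact: ccoef_exc0.
    rewrite /f c0 // c0; last by rewrite mulrN s0 oppr0.
    by rewrite !scale0r addr0 mem0v.
  have [g0 ratio] := ccoef_ratio eta_upper n1 nk i E0 bE thE s0.
  have s2 := doubled_neq0 n1 nk s0.
  have vl := cleared_limg k eta_upper n1 (i - s) (j + s) t.
  rewrite (cleared_two_terms eta_upper n1 nk i E0 bE thE s2) in vl.
  rewrite -/j -/P in ratio vl.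
  set g1 := ccoef eta k _ _ _ _ _ in g0 ratio vl; set g2 := ccoef eta k _ _ _ (- b') _ in ratio vl.
  set h1 := ccoef eta k P _ _ _ _ in ratio; set h2 := ccoef eta k P _ _ _ _ in ratio.
  have f1 : f (- b' + s) = h1 *: xx R (j + b' - s) (i - b' + s).
    by rewrite /f; congr (_ *: xx R _ _); ring.
  have f2 : f (- b' - s) = h2 *: xx R (j + b' + s) (i - b' - s).
    by rewrite /f; congr (_ *: xx R _ _); ring.
  rewrite f1 f2; move: (xx R _ _) (xx R _ _) vl => e2 e1 vl.
  move: h1 h2 g1 g2 g0 ratio vl {f1 f2} => h1 h2 g1 g2 g0 ratio vl.
  have h2E : h2 = h1 / g1 * g2 by rewrite mulrAC ratio mulfK.
  have -> : h1 *: e1 + h2 *: e2 = (h1 / g1) *: (g1 *: e1 + g2 *: e2).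
    by rewrite scalerDr !scalerA -h2E divfK.
  exact: memvZ.
have v1 : cleared eta k P i j t = \sum_s f (- b' + s).
  exact: (reindex_inj (addrI (- b'))).
have v2 : cleared eta k P i j t = \sum_s f (- b' - s).
  rewrite v1; exact: (reindex_inj oppr_inj).
have : cleared eta k P i j t + cleared eta k P i j t \in limg (R_diag n k eta t).
  by rewrite {1}v1 v2 -big_split; apply: memv_suml => s _; apply: pairP.
rewrite -mulr2n -scaler_nat => /(memvZ (2^-1)).
by rewrite scalerA mulVf ?scale1r // pnatr_eq0.
Qed.

Lemma cleared_ordinary_limg t i j : cleared eta k (ordinary k i j) i j t
  \in limg (R_diag n k eta t).
Proof.
have [D0|D0] := eqVneq (\prod_(a | ~~ ordinary k i j a) th a (- t)) 0; last first.
  have -> : cleared eta k (ordinary k i j) i j t =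
      (\prod_(a | ~~ ordinary k i j a) th a (- t))^-1 *: cleared eta k xpredT i j t.
    by rewrite cleared_split // scalerA mulVf // scale1r.
  by rewrite memvZ // cleared_limg.
move/eqP/prodf_eq0: D0 => [x xe /eqP thx].
have tt : torsion n eta t.
  apply: contrapT => nt.
  have ntN : ~ torsion n eta (- t) by move=> /(torsionN n1); rewrite opprK.
  by have := thetaZ_neq0 eta_upper n1 x ntN; rewrite thx eqxx.
move: tt => /(torsionP eta n)[a [b tE]].
have [E E0 thE] := thetaZ_class eta_upper n1 tE.
have xb : x = b%:~R.
  apply/eqP; apply/contraT => xb; move: thx.
  rewrite (thetaZ_class_opp eta_upper n1 _ thE) => /eqP.
  have bx : b%:~R - x != 0 by rewrite subr_eq0 eq_sym.
  have h1 := thetaZ_at0_neq0 eta_upper n1 bx.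
  have h2 : E * zchar R (- (x * a%:~R)) != 0 by apply: mulf_neq0 E0 (zchar_neq0 _ _).
  have h3 : - e_ (- (n%:R * t)) * zchar R x != 0.
    by apply: mulf_neq0; [rewrite oppr_eq0 e_neq0 | exact: zchar_neq0].
  by rewrite mulf_eq0 (negbTE h3) mulf_eq0 (negbTE h2) (negbTE h1).
pose b' := kz^-1 * x.
have ku := kz_unit n1 nk.
have bE : b%:~R = kz * b' by rewrite -xb /b' mulVKr.
have jE : j = i + (kz - 1) * b'.
  move: xe; rewrite negbK => /eqP xe.
  have : kz * (j - i) = kz * ((kz - 1) * b').
    by rewrite -xe xb bE; ring.
  by move/(mulrI ku) => <-; ring.
by rewrite jE; apply: cleared_exceptional_limg E0 bE thE.
Qed.

End Image.

Theorem proposition3p15 (R : realType) (eta : Cplx R)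
    (eta_upper : 0 < complex.Im eta) (n k : nat)
    (k_ge1 : (1 <= k)%N) (k_lt_n : (k < n)%N) (nk_coprime : coprime n k)
    (tau : Cplx R) :
  rel_ n k eta tau = limg (R_diag n k eta tau).
Proof.
have n1 : (1 < n)%N by apply: leq_ltn_trans k_lt_n.
apply/eqP; rewrite eqEsubv; apply/andP; split.
  apply/subv_sumP => -[i j] /= /asboolP /(r_nonzeroP eta_upper n1 nk_coprime) gr.
  by rewrite L_E // -memvE; apply: cleared_ordinary_limg.
apply/subvP => w /memv_imgP[u _ ->].
rewrite R_diagE // opxx_apply; apply: memv_suml => i _; apply: memv_suml => j _.
apply: memvZ; apply: memvZ; rewrite cleared_split //; apply: memvZ.
have [gr|ng] := pselect (exists r, active k i j r); last first.
  rewrite /cleared big1 ?mem0v // => r _.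
  rewrite /ccoef; case: ifPn => [g|_]; last exact: scale0r.
  by case: ng; exists r.
have rij : r_nonzero k eta i j by apply/(r_nonzeroP eta_upper n1 nk_coprime).
apply: (subvP (sumv_sup (i, j) _ (subvv _))); first exact/asboolP.
by rewrite L_E // memv_line.
Qed.
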